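(* Suppose $K$ is a scattered compact metrizable space, and $1 \leq p \leq q < \infty$. Then the space $\Pi_{qp}(C(K),\ell_q)$ is subprojective.
   Context: A topological space is scattered if every (nonempty) compact subset of it has an isolated point. $\Pi_{qp}(X,Y)$ is the space of $(q,p)$-summing operators from $X$ to $Y$, i.e. operators $T$ for which there is a constant $C$ such that for any $x_1,\ldots,x_n\in X$ $$\Big(\sum_i\|Tx_i\|^q\Big)^{1/q}\leq C\sup_{x^*\in X^*,\ \|x^*\|\le 1}\Big(\sum_i|x^*(x_i)|^p\Big)^{1/p},$$ normed by the smallest such $C$, denoted $\pi_{qp}(T)$. A Banach space $X$ is subprojective if every closed infinite dimensional subspace $Y \subset X$ contains a closed infinite dimensional subspace $Z \subset Y$ that is complemented in $X$. *)

(* Defs.v *)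
From HB Require Import structures.
From mathcomp Require Import all_boot all_order all_algebra.
From mathcomp Require Import all_classical all_reals all_analysis.

Set Implicit Arguments.
Unset Strict Implicit.
Unset Printing Implicit Defensive.

Import Order.TTheory GRing.Theory Num.Theory.
Import numFieldNormedType.Exports.

Local Open Scope classical_set_scope.
Local Open Scope ring_scope.

Definition metrizable (R : realType) (K : topologicalType) : Prop :=
  exists d : K -> K -> R,
    [/\ forall x y, d x y = 0 <-> x = y,
        forall x y, d x y = d y x,
        forall x y z, d x z <= d x y + d y z &
        forall x (A : set K),
          nbhs x A <-> exists2 e : R, 0 < e & [set y | d x y < e] `<=` A].

Definition scattered (K : topologicalType) : Prop :=
  forall A : set K, compact A -> A !=set0 -> exists x, isolated A x.

Section subprojective.
Context {R : realType}.

Definition finite_dimensional (X : normedModType R) (A : set X) : Prop :=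
  exists (n : nat) (v : 'I_n -> X),
    A `<=` [set \sum_(i < n) c i *: v i | c in [set: 'I_n -> R]].

Definition closed_inf_dim_subspace (X : normedModType R) (A : set X) : Prop :=
  [/\ submod_closed (mem A), closed A & ~ finite_dimensional A].

(* [Z] is complemented when it is the range of a bounded linear projection. *)
Definition complemented (X : normedModType R) (Z : set X) : Prop :=
  exists P : {linear X -> X},
    [/\ continuous P, range P = Z & forall z, Z z -> P z = z].

Definition subprojective (X : completeNormedModType R) : Prop :=
  forall Y : set X, closed_inf_dim_subspace Y ->
    exists Z : set X,
      [/\ Z `<=` Y, closed_inf_dim_subspace Z & complemented Z].

End subprojective.

Section finite_lq_norm.
Context {R : realType}.
Implicit Types (q : R) (n : nat).

Definition lq_norm q n (a : 'I_n -> R) : R :=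
  (\sum_(i < n) `|a i| `^ q) `^ q^-1.

Lemma lq_norm_ge0 q n (a : 'I_n -> R) : 0 <= lq_norm q a.
Proof. exact: powR_ge0. Qed.

Lemma le_lq_norm q n (a b : 'I_n -> R) : 1 <= q ->
  (forall i, `|a i| <= `|b i|) -> lq_norm q a <= lq_norm q b.
Proof.
move=> q1 ab; have q0 : 0 <= q by exact: le_trans q1.
apply: ge0_ler_powR; rewrite ?invr_ge0 ?nnegrE//.
- by apply: sumr_ge0 => i _; exact: powR_ge0.
- by apply: sumr_ge0 => i _; exact: powR_ge0.
- by apply: ler_sum => i _; apply: ge0_ler_powR; rewrite ?nnegrE.
Qed.

Let ext n (a : 'I_n -> R) (k : nat) : R := oapp a 0 (insub k).

Let ext_ord n (a : 'I_n -> R) (i : 'I_n) : ext a i = a i.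
Proof. by rewrite /ext valK. Qed.

Let Lnorm_ext q n (a : 'I_n -> R) : 0 < q ->
  Lnorm (counting : {measure set nat -> \bar R}) q%:E (EFin \o ext a)
  = (lq_norm q a)%:E.
Proof.
move=> q0; rewrite Lnorm_counting//.
rewrite (nneseries_split 0 n); last by move=> k _; rewrite lee_fin powR_ge0.
rewrite ereal_series_cond eseries0 ?adde0; last first.
  move=> k _; rewrite add0n => nk /=.
  by rewrite /ext insubF ?ltnNge ?(andP nk).1//= normr0 powR0// gt_eqF.
rewrite add0n big_mkord /lq_norm -poweR_EFin; congr poweR.
rewrite -sumEFin; apply: eq_bigr => i _.
by rewrite /= ext_ord.
Qed.

Lemma lq_normD q n (a b : 'I_n -> R) : 1 <= q ->
  lq_norm q (fun i => a i + b i) <= lq_norm q a + lq_norm q b.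
Proof.
move=> q1; have q0 : 0 < q by exact: lt_le_trans q1.
rewrite -lee_fin EFinD -!Lnorm_ext//.
have -> : ext (fun i => a i + b i) = (ext a \+ ext b)%R.
  by apply/funext => k; rewrite /= /ext; case: insub => //=; rewrite addr0.
by apply: minkowski_EFin.
Qed.

Lemma lq_normZ q n (c : R) (a : 'I_n -> R) : 1 <= q ->
  lq_norm q (fun i => c * a i) = `|c| * lq_norm q a.
Proof.
move=> q1; have q0 : 0 < q by exact: lt_le_trans q1.
rewrite /lq_norm; under eq_bigr do rewrite normrM powRM//.
have s0 : 0 <= \sum_i `|a i| `^ q by apply: sumr_ge0 => i _; exact: powR_ge0.
rewrite -mulr_sumr powRM ?powR_ge0//.
by rewrite -powRrM mulfV ?gt_eqF// powRr1.
Qed.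

Lemma lq_norm1 q (a : 'I_1 -> R) : 1 <= q -> lq_norm q a = `|a ord0|.
Proof.
move=> q1; have q0 : 0 < q by exact: lt_le_trans q1.
by rewrite /lq_norm big_ord1 -powRrM mulfV ?gt_eqF// powRr1.
Qed.

Lemma lq_norm_le_cst q n (a : 'I_n -> R) (d : R) : 1 <= q -> 0 <= d ->
  (forall i, `|a i| <= d) -> lq_norm q a <= n%:R `^ q^-1 * d.
Proof.
move=> q1 d0 ad; have q0 : 0 < q by exact: lt_le_trans q1.
apply: (@le_trans _ _ (lq_norm q (fun _ : 'I_n => d))).
  by apply: le_lq_norm => // i; rewrite (ger0_norm d0).
rewrite /lq_norm sumr_const card_ord -[_ *+ n]mulr_natl powRM ?powR_ge0//.
by rewrite -powRrM mulfV ?gt_eqF// powRr1// (ger0_norm d0).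
Qed.

Lemma lq_norm_lim q n (I : Type) (F : set_system I) (g : I -> 'I_n -> R)
    (a : 'I_n -> R) (B : R) : ProperFilter F -> 1 <= q ->
  (forall i, g s i @[s --> F] --> a i) ->
  (\forall s \near F, lq_norm q (g s) <= B) -> lq_norm q a <= B.
Proof.
move=> FF q1 ga gB; apply/ler_addgt0Pr => e e0.
pose c : R := n%:R `^ q^-1.
have c0 : 0 <= c by exact: powR_ge0.
pose d : R := e / (c + 1).
have d0 : 0 < d by rewrite divr_gt0// ltr_wpDl.
have near_ga : \forall s \near F, forall i, `|a i - g s i| <= d.
  apply: filter_forall => i.
  by have /cvgrPdist_le/(_ d d0) := ga i.
near F => s.
have -> : a = (fun i => g s i + (a i - g s i)).
  by apply/funext => i; rewrite addrC subrK.
apply: (le_trans (lq_normD _ _ q1)).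
apply: lerD; first by near: s.
apply: (@le_trans _ _ (c * d)).
  by apply: lq_norm_le_cst => //; [exact: ltW|near: s].
rewrite /d mulrCA ger_pMr// ler_pdivrMr ?ltr_wpDl// mul1r.
by rewrite lerDl.
Unshelve. all: by end_near. Qed.

End finite_lq_norm.

Lemma cvg_near_dist (R : realType) (V : normedModType R) (F : set_system V)
    (l : V) : ProperFilter F ->
  (forall e : R, 0 < e -> \forall v \near F, `|v - l| <= e) -> cvg F.
Proof.
move=> FF Fl; apply/cvg_ex; exists l.
apply/(@cvgrPdist_le _ _ _ F) => e e0; apply: filterS (Fl e e0) => v.
by rewrite distrC.
Qed.

Lemma cauchy_norm (R : realType) (V : normedModType R) (F : set_system V) :
  ProperFilter F -> cauchy F -> forall e : R, 0 < e ->
  exists2 A, F A & forall u v, A u -> A v -> `|u - v| <= e.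
Proof.
move=> FF /cauchyP Fc e e0.
have e20 : 0 < e / 2 by rewrite divr_gt0.
have [u Fu] := Fc _ e20.
exists (ball u (e / 2)) => // v w; rewrite -ball_normE /= => uv uw.
rewrite (_ : v - w = (u - w) - (u - v)); last by rewrite opprB [RHS]addrC subrKA.
rewrite (le_trans (ler_normB _ _))// [leRHS]splitr lerD//; exact: ltW.
Qed.

Lemma norm_cauchy (R : realType) (V : normedModType R) (F : set_system V) :
  ProperFilter F ->
  (forall e : R, 0 < e ->
    exists2 A, F A & forall u v, A u -> A v -> `|u - v| <= e) -> cauchy F.
Proof.
move=> FF h; apply: cauchy_exP => e e0.
have e20 : 0 < e / 2 by rewrite divr_gt0.
have [A FA Ae] := h _ e20.
have [u Au] := filter_ex FA.
exists u; apply: filterS FA => v Av; rewrite -ball_normE /=.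
by rewrite (le_lt_trans (Ae _ _ Au Av))// gtr_pMr// invf_lt1// ltr1n.
Qed.
(* The compactness proof is a parameter of the type because it is what makes
   the supremum below a norm. *)
Section continuous_functions.
Context {R : realType} {K : topologicalType}.

Definition continuous_pred : {pred K -> R} := mem [set f : K -> R | continuous f].

Record continuous_functions (cK : compact [set: K]) := ContinuousFunction {
  continuous_functions_fun :> K -> R ;
  _ : continuous_functions_fun \in continuous_pred }.

Lemma continuous_pred_submod_closed : submod_closed continuous_pred.
Proof.
split; first by rewrite inE => x; exact: cst_continuous.
move=> a f g; rewrite !inE /= => cf cg x.
by apply: cvgD; last exact: cg; exact: (cvgMl_tmp (cf x)).
Qed.

HB.instance Definition _ :=
  GRing.isSubmodClosed.Build R (K -> R) continuous_pred
    continuous_pred_submod_closed.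

Variable cK : compact [set: K].

HB.instance Definition _ := [isSub for @continuous_functions_fun cK].
HB.instance Definition _ := [Choice of continuous_functions cK by <:].
HB.instance Definition _ :=
  [SubChoice_isSubLmodule of continuous_functions cK by <:].

Definition sup_norm (f : continuous_functions cK) : R :=
  sup [set `|f x| | x in [set: K]].

Lemma continuous_functionsP (f : continuous_functions cK) : continuous f.
Proof. by case: f => f /= /[!inE]. Qed.

Lemma sup_norm_ub (f : continuous_functions cK) x : `|f x| <= sup_norm f.
Proof.
apply: ub_le_sup; last by exists x.
have : compact (f @` [set: K]).
  by apply: continuous_compact => //; apply: continuous_subspaceT;
     exact: continuous_functionsP.
move=> /compact_bounded[M [_ fM]]; exists (M + 1) => _ [y _ <-].
by apply: (fM (M + 1)); [rewrite ltrDl|exists y].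
Qed.

Lemma sup_norm_le (f : continuous_functions cK) M : 0 <= M ->
  (forall x, `|f x| <= M) -> sup_norm f <= M.
Proof.
move=> M0 fM; rewrite /sup_norm.
have [[x _]|/set0P/negP/negPn/eqP ->] := pselect ([set: K] !=set0).
  by apply: ge_sup; [exists `|f x|, x|move=> _ [y _ <-]].
by rewrite image_set0 sup0.
Qed.

Lemma sup_norm_ge0 (f : continuous_functions cK) : 0 <= sup_norm f.
Proof.
have [[x _]|/set0P/negP/negPn/eqP K0] := pselect ([set: K] !=set0).
  exact: le_trans (sup_norm_ub f x).
by rewrite /sup_norm K0 image_set0 sup0.
Qed.

Lemma sup_normD f g : sup_norm (f + g) <= sup_norm f + sup_norm g.
Proof.
apply: sup_norm_le => [|x]; first by rewrite addr_ge0// sup_norm_ge0.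
by rewrite (le_trans (ler_normD _ _))// lerD// sup_norm_ub.
Qed.

Lemma sup_normZ (a : R) f : sup_norm (a *: f) = `|a| * sup_norm f.
Proof.
have le b g : sup_norm (b *: g) <= `|b| * sup_norm g.
  apply: sup_norm_le => [|x]; first by rewrite mulr_ge0// sup_norm_ge0.
  by rewrite normrM ler_wpM2l// sup_norm_ub.
apply/eqP; rewrite eq_le le/=.
have [->|a0] := eqVneq a 0; first by rewrite normr0 mul0r sup_norm_ge0.
rewrite -ler_pdivlMl ?normr_gt0// -normfV.
by rewrite -[leLHS](_ : sup_norm (a^-1 *: (a *: f)) = _) ?le//
   scalerA mulVf// scale1r.
Qed.

Lemma sup_norm_eq0 f : sup_norm f = 0 -> f = 0.
Proof.
move=> f0; apply/val_inj/funext => x /=.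
by apply/normr0_eq0/le_anti; rewrite normr_ge0 andbT -f0 sup_norm_ub.
Qed.

HB.instance Definition _ := @Lmodule_isNormed.Build R (continuous_functions cK)
  sup_norm sup_normD sup_normZ sup_norm_eq0.

Lemma continuous_functions_normE (f : continuous_functions cK) :
  `|f| = sup [set `|f x| | x in [set: K]].
Proof. by []. Qed.

End continuous_functions.
Arguments continuous_functions R {K} cK.

Lemma ge1_EFin (R : realType) (q : R) : 1 <= q -> (1 <= q%:E)%E.
Proof. by rewrite lee_fin. Qed.

(* Elements are the sequences [u] with ['N[counting]_q[u] < +oo]; by
   [Lnorm_counting] this norm is [(\sum_(k <oo) |u k| ^ q) ^ (1 / q)]. *)
Definition lq_space (R : realType) (q : R) (q1 : 1 <= q) : Type :=
  LfunType (counting : {measure set nat -> \bar R})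
    (ge1_EFin q1).

Section lq_space.
Context {R : realType} {q : R} (q1 : 1 <= q).
Local Notation mu := (counting : {measure set nat -> \bar R}).
Local Notation lq := (lq_space q1).

HB.instance Definition _ :=
  GRing.Lmodule.copy lq (LfunType mu (ge1_EFin q1)).

Definition lq_space_fun (u : lq) : nat -> R := u.

Definition lq_space_norm (u : lq) : R :=
  fine (Lnorm mu q%:E (EFin \o lq_space_fun u)).

Let q0 : 0 < q. Proof. exact: lt_le_trans q1. Qed.

Lemma lq_space_normE (u : lq) :
  (lq_space_norm u)%:E = Lnorm mu q%:E (EFin \o lq_space_fun u).
Proof. exact: finite_norm_fine. Qed.

Lemma lq_space_normD (u v : lq) :
  lq_space_norm (u + v) <= lq_space_norm u + lq_space_norm v.
Proof. exact: ler_LnormD. Qed.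

Lemma lq_space_normZ (a : R) (u : lq) :
  lq_space_norm (a *: u) = `|a| * lq_space_norm u.
Proof.
by apply: EFin_inj; rewrite EFinM !lq_space_normE; exact: LnormZ.
Qed.

Lemma lq_norm_le_space n (u : lq) :
  lq_norm q (fun i : 'I_n => lq_space_fun u i) <= lq_space_norm u.
Proof.
rewrite -lee_fin lq_space_normE Lnorm_counting// /lq_norm -poweR_EFin.
apply: gt0_ler_poweR; rewrite ?invr_ge0 ?(ltW q0)//.
- by rewrite in_itv/= leey andbT lee_fin sumr_ge0// => i _; exact: powR_ge0.
- by rewrite in_itv/= leey andbT nneseries_ge0// => k _ _; rewrite lee_fin powR_ge0.
rewrite -sumEFin -(big_mkord xpredT (fun k => (`|lq_space_fun u k| `^ q)%:E)).
apply: le_trans (nneseries_lim_ge n _) => //.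
by move=> k _ _; rewrite lee_fin powR_ge0.
Qed.

Lemma Lnorm_counting_le (f : nat -> R) (B : R) : 0 <= B ->
  (forall n, lq_norm q (fun i : 'I_n => f i) <= B) ->
  (Lnorm mu q%:E (EFin \o f) <= B%:E)%E.
Proof.
move=> B0 fB; rewrite Lnorm_counting//.
have BE : B%:E = ((B `^ q)%:E `^ q^-1)%E.
  by rewrite poweR_EFin -powRrM mulfV ?gt_eqF// powRr1.
rewrite BE; apply: gt0_ler_poweR; rewrite ?invr_ge0 ?(ltW q0)//.
- by rewrite in_itv/= leey andbT nneseries_ge0// => k _ _; rewrite lee_fin powR_ge0.
- by rewrite in_itv/= leey andbT lee_fin powR_ge0.
apply: lime_le; first by apply: is_cvg_nneseries => k _ _; rewrite lee_fin powR_ge0.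
apply: nearW => n; rewrite big_mkord sumEFin lee_fin.
have s0 : 0 <= \sum_(i < n) `|f i| `^ q by apply: sumr_ge0 => i _; exact: powR_ge0.
have -> : \sum_(i < n) `|f i| `^ q = lq_norm q (fun i : 'I_n => f i) `^ q.
  by rewrite /lq_norm -powRrM mulVf ?gt_eqF// powRr1.
by apply: ge0_ler_powR; rewrite ?(ltW q0) ?nnegrE ?lq_norm_ge0.
Qed.

Lemma lq_space_coord (u : lq) k : `|lq_space_fun u k| <= lq_space_norm u.
Proof.
apply: le_trans (lq_norm_le_space k.+1 u).
rewrite /lq_norm big_ord_recr/=.
rewrite -[leLHS](powRr1 (normr_ge0 _)) -(mulfV (lt0r_neq0 q0)) powRrM.
apply: ge0_ler_powR; rewrite ?invr_ge0 ?(ltW q0) ?nnegrE ?powR_ge0//.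
  by rewrite addr_ge0 ?powR_ge0// sumr_ge0// => i _; exact: powR_ge0.
by rewrite lerDr sumr_ge0// => i _; exact: powR_ge0.
Qed.

Lemma lq_space_norm_eq0 (u : lq) : lq_space_norm u = 0 -> u = 0.
Proof.
move=> u0; apply/LfuneqP => k.
by apply/normr0_eq0/le_anti; rewrite normr_ge0 andbT -u0; exact: lq_space_coord.
Qed.

HB.instance Definition _ := @Lmodule_isNormed.Build R lq
  lq_space_norm lq_space_normD lq_space_normZ lq_space_norm_eq0.

Lemma lq_space_normrE (u : lq) :
  `|u| = fine (Lnorm mu q%:E (EFin \o lq_space_fun u)).
Proof. by []. Qed.

Lemma lq_space_complete (F : set_system lq) :
  ProperFilter F -> cauchy F -> cvg F.
Proof.
move=> FF Fc; have Fn := cauchy_norm FF Fc.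
have coordB (u v : lq) k : lq_space_fun (u - v) k = lq_space_fun u k - lq_space_fun v k.
  by [].
have cvgk k : cvg (lq_space_fun u k @[u --> F]).
  apply: cauchy_cvg; apply: norm_cauchy => e e0.
  have [A FA Ae] := Fn e e0.
  exists [set lq_space_fun u k | u in A].
    by apply: (@filterS _ F _ A) => // u Au; exists u.
  move=> _ _ [u Au <-] [v Av <-]; rewrite -coordB.
  exact: le_trans (lq_space_coord _ _) (Ae _ _ Au Av).
pose l k := lim (lq_space_fun u k @[u --> F]).
have tail (e : R) : 0 < e -> \forall u \near F, forall n,
    lq_norm q (fun i : 'I_n => lq_space_fun u i - l i) <= e.
  move=> e0; have [A FA Ae] := Fn e e0.
  apply: (@filterS _ F _ A) => // u Au n.
  apply: (@lq_norm_lim _ q n _ F (fun v i => lq_space_fun u i - lq_space_fun v i)) => //.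
    by move=> i; apply: cvgB; [exact: cvg_cst|exact: cvgk].
  apply: filterS FA => v Av.
  exact: le_trans (lq_norm_le_space _ (u - v)) (Ae _ _ Au Av).
have lL : l \in Lfun mu q%:E.
  have [u ul] := filter_ex (tail 1 ltr01).
  have uL : lq_space_fun u \in Lfun mu q%:E by exact: LfunP.
  have dL : (lq_space_fun u \- l)%R \in Lfun mu q%:E.
    rewrite inE; apply/andP; split; first by rewrite inE.
    rewrite inE /= /finite_norm; apply: le_lt_trans (ltry 1).
    by apply: Lnorm_counting_le.
  have -> : l = lq_space_fun u - (lq_space_fun u \- l)%R.
    by apply/funext => k; rewrite !fctE/= opprB addrC subrK.
  have q1' : (1 <= q%:E)%E by rewrite lee_fin.
  have [_ cl] := Lfun_submod_closed mu q1'.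
  by rewrite addrC -scaleN1r; exact: cl.
pose L : lq := Lfun_Sub (ge1_EFin q1) lL.
apply: (cvg_near_dist (l := L)) => e e0.
apply: filterS (tail e e0) => u ue.
rewrite -lee_fin [(`|_|)%:E](lq_space_normE (u - L)).
by apply: Lnorm_counting_le => //; exact: ltW.
Qed.

HB.instance Definition _ := Uniform_isComplete.Build lq lq_space_complete.

End lq_space.

Section summing_operators.
Context {R : realType}.

Section dual_ball.
Variable X : normedModType R.

(* A linear functional is in the closed unit ball of the dual when it is
   bounded by the norm; in particular it is then continuous. *)
Definition dual_ball : set {linear X -> R} :=
  [set phi | forall x, `|phi x| <= `|x|].

Definition weak_norm (p : R) n (x : 'I_n -> X) : R :=
  sup [set lq_norm p (fun i => phi (x i)) | phi in dual_ball].

End dual_ball.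

Variables (X Y : normedModType R).

Definition summing_bound (q p : R) (T : X -> Y) (C : R) : Prop :=
  0 <= C /\ forall (n : nat) (x : 'I_n -> X),
    lq_norm q (fun i => `|T (x i)|) <= C * weak_norm p x.

Definition summing_pred (q p : R) : {pred X -> Y} :=
  mem [set T : X -> Y |
    [/\ linear T, continuous T & exists C, summing_bound q p T C]].

Definition summing_norm (q p : R) (T : X -> Y) : R :=
  inf [set C | summing_bound q p T C].

(* The proofs of [1 <= p] and [p <= q] are parameters of the type because
   [summing_norm q p] need not be a norm without them. *)
Record summing_operators (q p : R) (p1 : 1 <= p) (pq : p <= q) :=
  SummingOperator {
    summing_fun :> X -> Y ;
    _ : summing_fun \in summing_pred q p }.

Section weak_norm_lemmas.
Variables (p : R) (p1 : 1 <= p).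

Lemma dual_ball0 : dual_ball (\0 : {linear X -> R}).
Proof. by move=> x; rewrite normr0. Qed.

Lemma weak_norm_ub n (x : 'I_n -> X) (phi : {linear X -> R}) :
  dual_ball phi -> lq_norm p (fun i => phi (x i)) <= weak_norm p x.
Proof.
move=> phiB; apply: ub_le_sup; last by exists phi.
exists (lq_norm p (fun i => `|x i|)) => _ [psi psiB <-].
by apply: le_lq_norm => // i; rewrite normr_id.
Qed.

Lemma weak_norm_ge0 n (x : 'I_n -> X) : 0 <= weak_norm p x.
Proof. exact: le_trans (lq_norm_ge0 _ _) (weak_norm_ub x dual_ball0). Qed.

Lemma weak_norm1 (x : 'I_1 -> X) : weak_norm p x <= `|x ord0|.
Proof.
apply: ge_sup.
  by eexists; exists (\0 : {linear X -> R}); [exact: dual_ball0|].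
by move=> _ [phi phiB <-]; rewrite lq_norm1.
Qed.

End weak_norm_lemmas.

Section bounds.
Variables (q p : R) (p1 : 1 <= p) (q1 : 1 <= q).
Implicit Types (T S : X -> Y) (C D a : R).

Lemma summing_bound_le T C : summing_bound q p T C ->
  forall x, `|T x| <= C * `|x|.
Proof.
move=> [C0 TC] x; have := TC 1%N (fun=> x).
rewrite lq_norm1// normr_id => /le_trans; apply.
by rewrite ler_wpM2l// (weak_norm1 p1 (fun=> x)).
Qed.

Lemma summing_boundD T S C D : summing_bound q p T C ->
  summing_bound q p S D -> summing_bound q p (T + S) (C + D).
Proof.
move=> [C0 TC] [D0 SD]; split=> [|n x]; first exact: addr_ge0.
rewrite mulrDl; apply: le_trans (lerD (TC n x) (SD n x)).
apply: le_trans (lq_normD _ _ q1); apply: le_lq_norm => // i.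
by rewrite normr_id ger0_norm ?addr_ge0// ler_normD.
Qed.

Lemma summing_boundZ a T C : summing_bound q p T C ->
  summing_bound q p (a *: T) (`|a| * C).
Proof.
move=> [C0 TC]; split=> [|n x]; first exact: mulr_ge0.
rewrite -mulrA; apply: le_trans (ler_wpM2l (normr_ge0 a) (TC n x)).
rewrite -[X in X * _](normr_id a) -lq_normZ//; apply: le_lq_norm => // i.
by rewrite normr_id normrM normr_id normr_id normrZ.
Qed.

Lemma summing_bound0 : summing_bound q p (0 : X -> Y) 0.
Proof.
split=> // n x; rewrite mul0r.
have := @lq_norm_le_cst _ q n (fun=> `|0 : Y|) 0 q1 (lexx 0).
by rewrite mulr0; apply => i; rewrite normr0 normr0.
Qed.

Lemma summing_norm_ge0 T : 0 <= summing_norm q p T.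
Proof.
have [[C TC]|/set0P/negP/negPn/eqP T0] := pselect ([set C | summing_bound q p T C] !=set0).
  by apply: lb_le_inf; [exists C|move=> D []].
by rewrite /summing_norm T0 inf0.
Qed.

Lemma summing_norm_lb T C : summing_bound q p T C -> summing_norm q p T <= C.
Proof. by move=> TC; apply: ge_inf => //; exists 0 => D []. Qed.

Lemma summing_norm_bound T : (exists C, summing_bound q p T C) ->
  summing_bound q p T (summing_norm q p T).
Proof.
move=> [C TC]; split=> [|n x]; first exact: summing_norm_ge0.
have := weak_norm_ge0 p1 x; rewrite le_eqVlt => /predU1P[w0|w0].
  by case: TC => _ /(_ n x); rewrite -w0 !mulr0.
rewrite -ler_pdivrMr//; apply: lb_le_inf; first by exists C.
by move=> D [_ TD]; rewrite ler_pdivrMr.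
Qed.

Lemma summing_pred_submod_closed : submod_closed (summing_pred q p).
Proof.
split=> [|a T S].
  rewrite inE; split; last by exists 0; exact: summing_bound0.
    by move=> a x y; rewrite /= scaler0 addr0.
  by move=> x; exact: cst_continuous.
move=> /set_mem[lT cT [C TC]] /set_mem[lS cS [D SD]]; apply/mem_set; split.
- move=> b x y; rewrite !fctE lT lS !scalerDr !scalerA (mulrC a b).
  by rewrite addrACA.
- move=> x; apply: cvgD; last exact: cS.
  exact: (cvgZl_tmp (cT x)).
- exists (`|a| * C + D); apply: summing_boundD => //.
  exact: summing_boundZ.
Qed.

End bounds.

Variables (q p : R) (p1 : 1 <= p) (pq : p <= q).
Let q1 : 1 <= q := le_trans p1 pq.
Local Notation Pi := (summing_operators p1 pq).

Section instances.

#[local] HB.instance Definition _ :=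
  GRing.isSubmodClosed.Build R (X -> Y) (summing_pred q p)
    (summing_pred_submod_closed p q1).

HB.instance Definition _ := [isSub for @summing_fun q p p1 pq].
HB.instance Definition _ := [Choice of Pi by <:].
HB.instance Definition _ := [SubChoice_isSubLmodule of Pi by <:].

End instances.

Lemma summing_operatorP (T : Pi) :
  [/\ linear T, continuous T & exists C, summing_bound q p T C].
Proof. by case: T => T /= /[!inE]. Qed.

Lemma summing_operator_bound (T : Pi) :
  summing_bound q p T (summing_norm q p T).
Proof. by apply: summing_norm_bound => //; case: (summing_operatorP T). Qed.

Let pi_norm (T : Pi) : R := summing_norm q p T.

Let pi_normD (S T : Pi) : pi_norm (S + T) <= pi_norm S + pi_norm T.
Proof.
by apply: summing_norm_lb; apply: summing_boundD => //;
  exact: summing_operator_bound.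
Qed.

Let pi_normZ (a : R) (T : Pi) : pi_norm (a *: T) = `|a| * pi_norm T.
Proof.
have le b (S : Pi) : pi_norm (b *: S) <= `|b| * pi_norm S.
  by apply: summing_norm_lb; apply: summing_boundZ => //;
    exact: summing_operator_bound.
apply/eqP; rewrite eq_le le/=.
have [->|a0] := eqVneq a 0.
  by rewrite normr0 mul0r; exact: summing_norm_ge0.
rewrite -ler_pdivlMl ?normr_gt0// -normfV.
have {1}-> : T = a^-1 *: (a *: T) by rewrite scalerA mulVf// scale1r.
exact: le.
Qed.

Let pi_norm_eq0 (T : Pi) : pi_norm T = 0 -> T = 0.
Proof.
move=> T0; apply/val_inj/funext => x /=.
apply/normr0_eq0/le_anti; rewrite normr_ge0 andbT.
have := summing_bound_le p1 q1 (summing_operator_bound T) x.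
by rewrite [summing_norm _ _ _]T0 mul0r.
Qed.

HB.instance Definition _ := @Lmodule_isNormed.Build R Pi
  pi_norm pi_normD pi_normZ pi_norm_eq0.

Lemma summing_operators_normE (T : Pi) : `|T| = summing_norm q p T.
Proof. by []. Qed.

End summing_operators.

Section summing_operators_complete.
Context {R : realType} (X : normedModType R) (Y : completeNormedModType R).
Variables (q p : R) (p1 : 1 <= p) (pq : p <= q).
Let q1 : 1 <= q := le_trans p1 pq.
Local Notation Pi := (summing_operators X Y p1 pq).

Lemma summing_operators_cauchy_cvg (F : set_system Pi) :
  ProperFilter F -> cauchy F -> cvg F.
Proof.
move=> FF Fc; have Fn := cauchy_norm FF Fc.
have le (T S : Pi) x : `|T x - S x| <= `|T - S| * `|x|.
  exact: (summing_bound_le p1 q1 (summing_operator_bound (T - S)) x).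
have cvgx x : cvg ((T : Pi) x @[T --> F]).
  apply: cauchy_cvg; apply: norm_cauchy => e e0.
  have d0 : 0 < e / (`|x| + 1) by rewrite divr_gt0// ltr_wpDl.
  have [A FA Ae] := Fn _ d0.
  exists [set (T : Pi) x | T in A].
    by apply: (@filterS _ F _ A) => // T AT; exists T.
  move=> _ _ [T AT <-] [S AS <-].
  apply: le_trans (le _ _ _) _.
  apply: le_trans (ler_wpM2r (normr_ge0 x) (Ae _ _ AT AS)) _.
  by rewrite mulrAC ler_pdivrMr ?ltr_wpDl// ler_wpM2l ?(ltW e0)// lerDl.
pose L x := lim ((T : Pi) x @[T --> F]).
have linL : linear L.
  move=> a x y; apply: cvg_lim => //.
  rewrite (_ : (fun T : Pi => _) = (fun T : Pi => a *: T x + T y)); last first.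
    by apply/funext => T; case: (summing_operatorP T) => lT _ _; exact: lT.
  by apply: cvgD; [exact: (cvgZl_tmp (cvgx x))|exact: cvgx].
have tail (e : R) : 0 < e ->
    \forall T \near F, summing_bound q p (summing_fun (T : Pi) - L) e.
  move=> e0; have [A FA Ae] := Fn e e0.
  apply: (@filterS _ F _ A) => // T AT; split=> [|n x]; first exact: ltW.
  apply: (@lq_norm_lim _ q n _ F (fun (S : Pi) i => `|T (x i) - S (x i)|)) => //.
    by move=> i; apply: cvg_norm; apply: cvgB; [exact: cvg_cst|exact: cvgx].
  apply: (@filterS _ F _ A) => // S AS.
  have [_ /(_ n x) TS] := summing_operator_bound (T - S).
  apply: le_trans TS _; apply: ler_wpM2r; first exact: weak_norm_ge0.
  exact: Ae.
have bL : exists C, summing_bound q p L C.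
  have [T Tb] := filter_ex (tail 1 ltr01).
  have := summing_boundD q1 (summing_operator_bound T) (summing_boundZ q1 (-1) Tb).
  rewrite scaleN1r opprB addrC subrK => bL.
  by eexists; exact: bL.
have cL : continuous L.
  have [C bC] := bL.
  pose Llin : {linear X -> Y} := HB.pack L (GRing.isLinear.Build _ _ _ _ L linL).
  apply: (@bounded_linear_continuous _ _ _ Llin).
  apply/linear_boundedP; near=> r => x.
  apply: le_trans (summing_bound_le p1 q1 bC x) _.
  by rewrite ler_wpM2r//; near: r; exact: nbhs_pinfty_ge.
have LP : L \in summing_pred q p by rewrite inE.
apply: (cvg_near_dist (l := SummingOperator p1 pq LP)) => e e0.
apply: filterS (tail e e0) => T Tb.
exact: summing_norm_lb Tb.
Unshelve. all: by end_near. Qed.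

HB.instance Definition _ :=
  Uniform_isComplete.Build Pi summing_operators_cauchy_cvg.

End summing_operators_complete.

(* Main.v *)
Require Import Defs.
From HB Require Import structures.
From mathcomp Require Import all_boot all_order all_algebra.
From mathcomp Require Import all_classical all_reals all_analysis.
From mathcomp Require Import lra.

(** A summing operator [S] from C(K) to l_q is treated as an infinite matrix. Its
    rows are the coordinates of l_q. Its columns are indexed by the points of
    [K]: the column at [x] is the mass of [S] at [x], a vector of l_q, and the
    rank-one operator that it defines is called an atom below. The atom is the
    limit of the operators [f |-> S (c_k f)] along cutoffs [c_k] shrinking to
    [x].

    Everything rests on one inequality ([comp_mulc_lower]): if functions [h_k]
    satisfy [sum_k |h_k| <= 1] on [K], then
    [sum_k pi(S o M_(h_k))^q <= pi(S)^q], because admissible families for the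
    operators [S o M_(h_k)] merge into one admissible family for [S]. It makes the
    operators [S o M_(c_k)] converge in the summing norm ([comp_cut_cvg]), and
    it says that disjoint groups of columns satisfy a lower q-estimate
    ([atoms_upto_lower]). Disjoint groups of rows satisfy an upper q-estimate
    ([rows_window_upper]), because the values lie in l_q.

    Scatteredness makes the matrix determine the operator: the multipliers [h]
    for which [S o M_h] is a limit both of its finite sets of rows and of its
    finite sets of columns form an ideal of C(K). The common zeros of a proper
    ideal form a nonempty compact set, which has an isolated point [x], and this
    is excluded by the convergence of the [S o M_(c_k)] to the atom at [x]
    ([scattered_ideal], [scattered_approximable]). The same principle shows
    that [K] is countable, so that the columns can be enumerated.

    Now let [Y] be a closed infinite-dimensional space of such operators. If
    some row is persistent on [Y], that is, not small on any subspace of finite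
    codimension, then humps moving along this row span a complemented copy of
    l_1. If no row is persistent but some column is, humps moving along that
    column span a copy of l_q. If neither happens, unit vectors of [Y] can be
    found beyond any finite set of rows and columns, and humps moving in both
    directions span a copy of l_q: the upper estimate comes from the rows and
    the lower one, which bounds the projection, from the columns. The three
    constructions are instances of [gliding_hump], which turns an upper and a
    lower r-estimate into a bounded projection onto the span. *)

Set Implicit Arguments.
Unset Strict Implicit.
Unset Printing Implicit Defensive.

Import Order.TTheory GRing.Theory Num.Theory.
Import numFieldNormedType.Exports.

Local Open Scope classical_set_scope.
Local Open Scope ring_scope.

(** * Finite sums of powers and duality of the r-norm *)

Section finite_sums.
Context {R : realType}.
Implicit Types (p q r : R) (J : finType).

Lemma powR_ler r (a b : R) : 0 < r -> 0 <= a -> 0 <= b ->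
  (a `^ r <= b `^ r) = (a <= b).
Proof.
move=> r0 a0 b0; apply/idP/idP; last first.
  by move=> ab; apply: (ge0_ler_powR (ltW r0)) => //; rewrite nnegrE.
apply: contraTT; rewrite -!ltNge => ba.
by apply: gt0_ltr_powR; rewrite ?nnegrE.
Qed.

Lemma powRVK r (a : R) : 0 < r -> 0 <= a -> (a `^ r^-1) `^ r = a.
Proof. by move=> r0 a0; rewrite -powRrM mulVf ?gt_eqF// powRr1. Qed.

Lemma sum_powR_ge0 J (a : J -> R) r : 0 <= \sum_j `|a j| `^ r.
Proof. by apply: sumr_ge0 => i _; exact: powR_ge0. Qed.

Lemma lq_norm_leP r n (a : 'I_n -> R) (B : R) : 0 < r -> 0 <= B ->
  (lq_norm r a <= B) = (\sum_i `|a i| `^ r <= B `^ r).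
Proof.
move=> r0 B0; rewrite -(powR_ler r0) ?lq_norm_ge0//.
by rewrite powRVK// sum_powR_ge0.
Qed.

Lemma ler_norm_root_sum J (a : J -> R) r i : 0 < r ->
  `|a i| <= (\sum_j `|a j| `^ r) `^ r^-1.
Proof.
move=> r0; rewrite -(powR_ler r0) ?powR_ge0// powRVK ?sum_powR_ge0//.
by rewrite (bigD1 i)//= lerDl sumr_ge0// => j _; exact: powR_ge0.
Qed.

(** Normalizing the larger exponent's sum to one makes every term at most
    one, and powers of such a term decrease with the exponent. *)
Lemma lq_norm_decr p q n (a : 'I_n -> R) : 0 < p -> p <= q ->
  lq_norm q a <= lq_norm p a.
Proof.
move=> p0 pq; have q0 := lt_le_trans p0 pq.
rewrite lq_norm_leP ?lq_norm_ge0//.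
set s := lq_norm p a; have s0 : 0 <= s by exact: lq_norm_ge0.
have [s00|sN0] := eqVneq s 0.
  rewrite s00 powR0 ?gt_eqF// big1// => i _.
  have := ler_norm_root_sum a i p0; rewrite -[leRHS]/s s00 => ai.
  have /eqP -> : `|a i| == 0 by rewrite eq_le ai normr_ge0.
  by rewrite powR0// gt_eqF.
have {sN0 s0} s0 : 0 < s by rewrite lt_def sN0.
have E : s `^ q = s `^ (q - p) * \sum_i `|a i| `^ p.
  rewrite -(powRVK p0 (sum_powR_ge0 a p)) -powRD ?subrK//.
  by apply/implyP => _; rewrite gt_eqF.
rewrite E mulr_sumr; apply: ler_sum => i _.
have [->|ai0] := eqVneq (a i) 0.
  by rewrite normr0 !powR0 ?mulr0 ?gt_eqF.
have -> : `|a i| `^ q = `|a i| `^ (q - p) * `|a i| `^ p.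
  by rewrite -powRD ?subrK//; apply/implyP => _; rewrite normr_eq0.
apply: ler_wpM2r; first exact: powR_ge0.
apply: ge0_ler_powR; rewrite ?subr_ge0 ?nnegrE ?(ltW s0)//.
exact: ler_norm_root_sum.
Qed.

Lemma lq_norm_le_sum r n (a : 'I_n -> R) : 1 <= r ->
  lq_norm r a <= \sum_i `|a i|.
Proof.
move=> r1; apply: le_trans (lq_norm_decr a ltr01 r1) _.
rewrite /lq_norm invr1 powRr1 ?sum_powR_ge0//.
by apply: ler_sum => i _; rewrite powRr1.
Qed.

Lemma young r (x y : R) : 1 <= r -> 0 <= x -> 0 <= y ->
  x `^ (r - 1) * y <= (1 - r^-1) * x `^ r + r^-1 * y `^ r.
Proof.
move=> r1 x0 y0; have r0 := lt_le_trans ltr01 r1.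
have [->|rN1] := eqVneq r 1.
  by rewrite subrr powRr0 invr1 subrr !mul1r mul0r add0r powRr1.
have r1' : 0 < r - 1 by rewrite subr_gt0 lt_def rN1.
have E : (r / (r - 1))^-1 = 1 - r^-1.
  by rewrite invf_div mulrBl mulfV ?gt_eqF// mul1r.
have r'0 : 0 < r / (r - 1) by rewrite divr_gt0.
have := @conjugate_powR R (x `^ (r - 1)) y (r / (r - 1)) r
  (powR_ge0 _ _) y0 r'0 r0.
rewrite E subrK => /(_ erefl); rewrite -powRrM mulrCA mulfV ?gt_eqF// mulr1.
by rewrite [X in _ <= X + _]mulrC [X in _ <= _ + X]mulrC.
Qed.

(** Finite-dimensional duality of the r-norm: the coefficients are those of
    the equality case of Hoelder's inequality. *)
Lemma root_sum_dual J r (a : J -> R) : 1 <= r ->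
  exists b : J -> R,
    \sum_j b j * a j = (\sum_j `|a j| `^ r) `^ r^-1 /\
    forall c : J -> R, `|\sum_j b j * c j| <= (\sum_j `|c j| `^ r) `^ r^-1.
Proof.
move=> r1; have r0 := lt_le_trans ltr01 r1.
set s := (\sum_j `|a j| `^ r) `^ r^-1; have s0 : 0 <= s by exact: powR_ge0.
have [s00|sN0] := eqVneq s 0.
  exists (fun=> 0); split; first by rewrite s00 big1// => j _; rewrite mul0r.
  by move=> c; rewrite big1 ?normr0 ?powR_ge0// => j _; rewrite mul0r.
have {sN0 s0} s0 : 0 < s by rewrite lt_def sN0.
have sr : s `^ r = \sum_j `|a j| `^ r by rewrite powRVK// sum_powR_ge0.
clearbody s.
exists (fun j => Num.sg (a j) * (`|a j| / s) `^ (r - 1)); split.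
  have sE : s = s `^ r / s `^ (r - 1).
    rewrite -powRB ?opprB ?subrKC ?powRr1 ?ltW//.
    by apply/implyP => _; rewrite gt_eqF.
  rewrite [RHS]sE sr mulr_suml; apply: eq_bigr => j _.
  rewrite mulrAC -normrEsg powRM ?invr_ge0 ?(ltW s0)//.
  rewrite mulrA mulr_powRB1//; congr (_ * _).
  by rewrite -[s^-1](powR_inv1 (ltW s0)) powRAC powR_inv1// powR_ge0.
move=> c; set t := (X in _ <= X); have t0 : 0 <= t by exact: powR_ge0.
have ct j : `|c j| <= t by exact: ler_norm_root_sum.
have [t00|tN0] := eqVneq t 0.
  rewrite big1 ?normr0// => j _; have := ct j; rewrite t00 normr_le0 => /eqP ->.
  by rewrite mulr0.
have {tN0 t0} t0 : 0 < t by rewrite lt_def tN0.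
have tr : t `^ r = \sum_j `|c j| `^ r by rewrite powRVK// sum_powR_ge0.
clearbody t.
apply: le_trans (ler_norm_sum _ _ _) _.
rewrite -[leRHS]mul1r -ler_pdivrMr// mulr_suml.
apply: (@le_trans _ _ (\sum_j ((1 - r^-1) * (`|a j| / s) `^ r +
                               r^-1 * (`|c j| / t) `^ r))).
  apply: ler_sum => j _; rewrite !normrM -!mulrA [leLHS]mulrA.
  have a0 : 0 <= `|a j| / s by rewrite divr_ge0// ltW.
  have c0 : 0 <= `|c j| / t by rewrite divr_ge0// ltW.
  refine (le_trans _ (young r1 a0 c0)).
  rewrite (ger0_norm (powR_ge0 _ _)); apply: ler_wpM2r => //.
  apply: ler_piMl; first exact: powR_ge0.
  by rewrite normr_sg lern1 leq_b1.
rewrite big_split/= -!mulr_sumr.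
have N (d : J -> R) (u : R) : 0 < u -> u `^ r = \sum_j `|d j| `^ r ->
    \sum_j (`|d j| / u) `^ r = 1.
  move=> u0 ur; under eq_bigr do rewrite powRM ?invr_ge0 ?(ltW u0)//.
  rewrite -mulr_suml -ur -powRM ?invr_ge0 ?(ltW u0)//.
  by rewrite mulfV ?gt_eqF// powR1.
by rewrite !N// !mulr1 subrK.
Qed.

Lemma bounded_sum_tail (a : nat -> R) (B : R) : (forall k, 0 <= a k) ->
  (forall n, \sum_(k < n) a k <= B) ->
  forall e, 0 < e -> exists N, forall m n, (N <= m)%N ->
    \sum_(m <= k < n) a k <= e.
Proof.
move=> a0 aB e e0.
pose E := [set \sum_(k < n) a k | n in [set: nat]].
have supE : has_sup E.
  by split; [exists 0, 0%N; rewrite ?big_ord0|exists B => _ [n _ <-]].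
have [_ [N _ <-] sN] := sup_adherent e0 supE.
exists N => m n Nm; have [nm|/ltnW mn] := leqP n m.
  by rewrite big_geq ?ltW.
have := sup_upper_bound supE; move=> /(_ (\sum_(k < n) a k)).
have nE : E (\sum_(k < n) a k) by exists n.
move=> /(_ nE) le; rewrite -(lerD2l (\sum_(k < m) a k)).
rewrite -!(big_mkord xpredT) -big_cat_nat//= big_mkord.
apply: le_trans le _; rewrite -lerBlDr; apply: (le_trans (ltW sN)).
rewrite -(big_mkord xpredT) (@big_cat_nat _ _ _ N 0 m)//=.
by rewrite lerDl sumr_ge0.
Qed.

End finite_sums.

(** * Dependent choice, finite codimension and limits in normed spaces *)

Section choice_and_dimension.

(** Dependent choice in which the [k]-th choice may consult all earlier ones. The
    first hypothesis says that [G k f] reads [f] below [k] only. *)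
Lemma history_choice (T : Type) (t0 : T) (G : nat -> (nat -> T) -> T -> Prop) :
  (forall k f g t, (forall i, (i < k)%N -> f i = g i) ->
    G k f t -> G k g t) ->
  (forall k f, (forall i, (i < k)%N -> G i f (f i)) -> exists t, G k f t) ->
  exists f, forall k, G k f (f k).
Proof.
move=> Gext Gex.
pose nxt k f :=
  if pselect (exists t, G k f t) is left h then projT1 (cid h) else t0.
pose F := fix F k : nat -> T := if k is k'.+1 then
  (fun i => if i == k' then nxt k' (F k') else F k' i) else (fun=> t0).
pose f k := nxt k (F k).
have Ff k i : (i < k)%N -> F k i = f i.
  elim: k => // k IH; rewrite ltnS leq_eqVlt => /predU1P[->|ik] /=.
    by rewrite eqxx.
  by rewrite ltn_eqF// IH.
exists f => k; have [n kn] := ubnP k; elim: n k kn => // n IH k /ltnSE kn.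
have /Gex : forall i, (i < k)%N -> G i (F k) (F k i).
  move=> i ik; rewrite Ff//; apply: (Gext i f); last first.
    by apply: IH; exact: leq_trans ik kn.
  by move=> j ji; rewrite Ff// (ltn_trans ji).
move=> ex; apply: (Gext k (F k)); first by move=> i ik; rewrite Ff.
by rewrite /f /nxt; case: pselect => // h; case: (cid h).
Qed.

Context {R : realType}.

Definition killed (X : normedModType R) (Psi : seq {linear X -> R}) (x : X) :=
  all (fun g : {linear X -> R} => g x == 0) Psi.

Lemma submodP (X : normedModType R) (Y : set X) : submod_closed (mem Y) ->
  [/\ Y 0, forall a u, Y u -> Y (a *: u), forall u v, Y u -> Y v -> Y (u + v) &
      forall n (a : nat -> R) (u : nat -> X), (forall k, (k < n)%N -> Y (u k)) ->
        Y (\sum_(k < n) a k *: u k)].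
Proof.
move=> [/set_mem Y0 Yl].
have YZ a u : Y u -> Y (a *: u).
  move=> Yu; have /set_mem := Yl a u 0 (mem_set Yu) (mem_set Y0).
  by rewrite addr0.
have YD u v : Y u -> Y v -> Y (u + v).
  move=> Yu Yv; have /set_mem := Yl 1 u v (mem_set Yu) (mem_set Yv).
  by rewrite scale1r.
split=> // n a u; elim: n => [|n IH] Yu; first by rewrite big_ord0.
rewrite big_ord_recr /=; apply: YD; last by apply: YZ; exact: Yu.
by apply: IH => k kn; apply: Yu; exact: ltnW.
Qed.

(** Intersecting with a hyperplane loses at most one dimension, so finitely
    many functionals cannot separate zero in an infinite-dimensional space. *)
Lemma infinite_dim_killed (X : normedModType R) (Psi : seq {linear X -> R})
    (Y : set X) : submod_closed (mem Y) -> ~ finite_dimensional Y ->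
  exists x, [/\ Y x, x != 0 & killed Psi x].
Proof.
elim: Psi Y => [|g Psi IH] Y Ysub Yinf.
  apply: contrapT => no; apply: Yinf; exists 0%N, (fun=> 0) => x Yx.
  exists (fun=> 0) => //; rewrite big_ord0.
  apply/esym/eqP/negPn/negP => x0; apply: no; exists x; split => //.
have [Y0 YZ YD YS] := submodP Ysub.
pose Yg := Y `&` [set x | g x = 0].
have [x [[Yx gx] x0 kx]] : exists x, [/\ Yg x, x != 0 & killed Psi x].
  apply: IH => [|[n [v Yv]]].
    split; first by apply/mem_set; split=> //=; rewrite linear0.
    move=> a u v /set_mem[Yu gu] /set_mem[Yv gv]; apply/mem_set; split => /=.
      by apply: YD => //; exact: YZ.
    by rewrite linearP gu gv scaler0 addr0.
  apply: Yinf.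
  have [[y0 [Yy0 gy0]]|no] := pselect (exists y, Y y /\ g y <> 0); last first.
    exists n, v => y Yy; apply: Yv; split=> //=; apply: contrapT => gy.
    by apply: no; exists y.
  exists n.+1, (fun i => oapp v y0 (unlift ord0 i)) => y Yy.
  have /Yv[c _ cE] : Yg (y - (g y / g y0) *: y0).
    split => /=.
      by rewrite -scaleNr; apply: YD => //; exact: YZ.
    have E : (g y / g y0) *: g y0 = g y by apply: divfK; exact/eqP.
    by rewrite linearB linearZ /= E subrr.
  exists (fun i => oapp c (g y / g y0) (unlift ord0 i)) => //.
  rewrite big_ord_recl unlift_none /=.
  under eq_bigr do rewrite liftK /=.
  by rewrite cE addrC subrK.
by exists x; split => //; rewrite /killed /= gx eqxx.
Qed.

(** If [n] vectors spanned [Z], the identity matrix of size [n + 1] would factor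
    through a space of dimension [n]. *)
Lemma biorthogonal_infinite_dim (X : normedModType R) (Z : set X)
    (s : nat -> X) (g : nat -> {linear X -> R}) :
  (forall k, Z (s k)) -> (forall j k, g j (s k) = (j == k)%:R) ->
  ~ finite_dimensional Z.
Proof.
move=> Zs gs [n [v Zv]].
have /choice[c cE] : forall k, exists c : 'I_n -> R,
    \sum_(i < n) c i *: v i = s k.
  by move=> k; have [c _ cE] := Zv _ (Zs k); exists c.
pose A : 'M[R]_(n.+1, n) := \matrix_(k, i) c k i.
pose G : 'M[R]_(n, n.+1) := \matrix_(i, j) g j (v i).
have AG : A *m G = 1%:M.
  apply/matrixP => k j; rewrite !mxE eq_sym -gs -cE linear_sum.
  by apply: eq_bigr => i _; rewrite !mxE linearZ.
have := leq_trans (mxrankM_maxl A G) (rank_leq_col A).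
by rewrite AG mxrank1 ltnn.
Qed.

Lemma norm_cauchy_seq (X : completeNormedModType R) (u : nat -> X) :
  (forall e : R, 0 < e -> exists N, forall n, (N <= n)%N ->
    `|u n - u N| <= e) -> cvg (u @ \oo).
Proof.
move=> uC; apply: cauchy_cvg; apply: norm_cauchy => e e0.
have [N uN] := uC (e / 2) (divr_gt0 e0 (ltr0Sn _ 1)).
exists [set v | `|v - u N| <= e / 2].
  by exists N => // n /= Nn; exact: uN.
move=> v w /= vN wN; rewrite [leRHS]splitr.
rewrite (_ : v - w = (v - u N) - (w - u N)); last by rewrite opprB addrA subrK.
by apply: le_trans (ler_normB _ _) _; exact: lerD.
Qed.

Lemma bounded_continuous (X Y : normedModType R) (f : {linear X -> Y}) (B : R) :
  (forall x, `|f x| <= B * `|x|) -> continuous f.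
Proof.
move=> fB; apply: bounded_linear_continuous; apply/linear_boundedP.
near=> b => x; apply: le_trans (fB x) _.
by rewrite ler_wpM2r//; near: b; exact: nbhs_pinfty_ge.
Unshelve. all: by end_near. Qed.

Lemma cvg_norm_le (X : normedModType R) (u : nat -> X) (l : X) (B : R) :
  u @ \oo --> l -> (forall n, `|u n| <= B) -> `|l| <= B.
Proof.
move=> ul uB.
apply: (@closed_cvg _ _ \oo _ u [set x : X | `|x| <= B]) ul.
  have -> : [set x : X | `|x| <= B] = Num.norm @^-1` [set y : R | y <= B] by [].
  apply: preimage_closed; [by move=> x _; exact: norm_continuous|exact: closed_le].
by apply: nearW => n; exact: uB.
Qed.

End choice_and_dimension.

(** * Projections onto almost biorthogonal sequences *)

Section triangular_projection.
Context {R : realType} (X : completeNormedModType R).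
Variables (s : nat -> X) (phi : nat -> {linear X -> R}).

(** Corrects the coordinates one at a time, so that the remainder
    [x - triangular_proj n x] is annihilated by the first [n] functionals. *)
Fixpoint triangular_proj n (x : X) : X :=
  if n is k.+1 then
    triangular_proj k x + phi k (x - triangular_proj k x) *: s k
  else 0.

Definition triangular_coord k (x : X) : R := phi k (x - triangular_proj k x).

Lemma triangular_projE n x :
  triangular_proj n x = \sum_(k < n) triangular_coord k x *: s k.
Proof. by elim: n => [|n IH]; rewrite ?big_ord0// big_ord_recr/= -IH. Qed.

Lemma triangular_proj_linear n : linear (triangular_proj n).
Proof.
elim: n => [|n IH] a x y /=; first by rewrite scaler0 addr0.
rewrite IH opprD addrACA -scalerBr linearP /=.
rewrite scalerDr scalerA scalerDl -!addrA; congr (_ + _).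
by rewrite addrCA; congr (_ + _); rewrite addrC.
Qed.

Lemma triangular_coord_linear k : linear (triangular_coord k : X -> R).
Proof.
move=> a x y; rewrite /triangular_coord triangular_proj_linear.
by rewrite opprD addrACA -scalerBr linearP.
Qed.

Hypothesis phi_diag : forall k, phi k (s k) = 1.
Hypothesis phi_lt : forall l k, (l < k)%N -> phi l (s k) = 0.

Lemma triangular_proj_basis n l :
  triangular_proj n (s l) = if (l < n)%N then s l else 0.
Proof.
elim: n => // n IH /=; rewrite IH ltnS.
have [ln|nl|->] := ltngtP l n.
- by rewrite subrr linear0 scale0r addr0.
- by rewrite subr0 phi_lt// scale0r addr0.
- by rewrite subr0 phi_diag scale1r add0r.
Qed.

Lemma triangular_coord_basis k l : triangular_coord k (s l) = (k == l)%:R.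
Proof.
rewrite /triangular_coord triangular_proj_basis.
have [lk|kl|->] := ltngtP l k; first by rewrite subrr linear0.
  by rewrite subr0 phi_lt.
by rewrite subr0 phi_diag.
Qed.

Variables (Y : set X) (r C : R).
Hypotheses (r1 : 1 <= r) (Ysub : submod_closed (mem Y)) (Ycl : closed Y).
Hypothesis Ys : forall k, Y (s k).
Hypothesis lower : forall n x, lq_norm r (fun k : 'I_n => phi k x) <= C * `|x|.
Hypothesis upper : forall n (a : nat -> R),
  `|\sum_(k < n) a k *: s k| <= C * lq_norm r (fun k : 'I_n => a k).
(* [C + 1] will bound every corrected coordinate, so the sum below controls the
   correction that the k-th functional undergoes. *)
Hypothesis small : forall k,
  (C + 1) * \sum_(l < k) `|phi k (s l)| <= 2^-1 ^+ k.+1.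

Let C0 : 0 <= C.
Proof.
have := lower 1 (s 0%N); rewrite lq_norm1// phi_diag normr1.
have := normr_ge0 (s 0%N); have [//|Cn s0 C1] := leP 0 C.
have : C * `|s 0%N| <= 0 by rewrite nmulr_rle0.
by move=> /(le_trans C1); rewrite ler10.
Qed.

Let half_ge0 k : 0 <= 2^-1 ^+ k :> R.
Proof. by rewrite exprn_ge0// invr_ge0. Qed.

Let half_le1 k : 2^-1 ^+ k <= 1 :> R.
Proof. by rewrite exprn_ile1// ?invr_ge0// invf_le1// ler1n. Qed.

Let sum_half n : \sum_(k < n) 2^-1 ^+ k.+1 <= 1 :> R.
Proof.
suff -> : \sum_(k < n) 2^-1 ^+ k.+1 = 1 - 2^-1 ^+ n :> R.
  by rewrite lerBlDr lerDl.
elim: n => [|n IH]; first by rewrite big_ord0 expr0 subrr.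
rewrite big_ord_recr/= IH.
rewrite exprS; lra.
Qed.

(** The correction subtracts [phi k] of a combination of the earlier vectors, on
    which [phi k] is tiny; the coefficients of that combination are bounded
    by induction, hence the two estimates are proved together. *)
Lemma triangular_coord_near k x :
  `|triangular_coord k x - phi k x| <= 2^-1 ^+ k.+1 * `|x|
  /\ `|triangular_coord k x| <= (C + 1) * `|x|.
Proof.
have [n kn] := ubnP k; elim: n k kn => // n IH k /ltnSE kn.
have near : `|triangular_coord k x - phi k x| <= 2^-1 ^+ k.+1 * `|x|.
  rewrite /triangular_coord linearB addrAC subrr add0r normrN.
  rewrite triangular_projE linear_sum.
  apply: le_trans (ler_norm_sum _ _ _) _.
  apply: (@le_trans _ _ (\sum_(l < k) ((C + 1) * `|x|) * `|phi k (s l)|)).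
    apply: ler_sum => l _; rewrite linearZ normrM.
    apply: ler_wpM2r => //; apply: (IH l _).2.
    exact: leq_trans (ltn_ord l) kn.
  by rewrite -mulr_sumr mulrAC; apply: ler_wpM2r.
split=> //; rewrite -[triangular_coord k x](subrK (phi k x)).
apply: le_trans (ler_normD _ _) _; rewrite mulrDl addrC mul1r.
apply: lerD.
  apply: le_trans (lower k.+1 x).
  by apply: (ler_norm_root_sum (fun i : 'I_k.+1 => phi i x) ord_max);
    exact: lt_le_trans r1.
by apply: le_trans near _; apply: ler_piMl.
Qed.

Lemma triangular_coord_lower n x :
  lq_norm r (fun k : 'I_n => triangular_coord k x) <= (C + 1) * `|x|.
Proof.
have -> : (fun k : 'I_n => triangular_coord k x) = (fun k : 'I_n =>
    phi k x + (triangular_coord k x - phi k x)).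
  by apply/funext => k; rewrite addrC subrK.
apply: le_trans (lq_normD _ _ r1) _; rewrite mulrDl; apply: lerD => //.
apply: le_trans (lq_norm_le_sum _ r1) _.
apply: (@le_trans _ _ (\sum_(k < n) 2^-1 ^+ k.+1 * `|x|)).
  by apply: ler_sum => k _; case: (triangular_coord_near k x).
by rewrite -mulr_suml; apply: ler_wpM2r.
Qed.

Lemma triangular_proj_cvg x : cvg (triangular_proj n x @[n --> \oo]).
Proof.
have r0 : 0 < r by exact: lt_le_trans r1.
apply: norm_cauchy_seq => e e0.
have e'0 : 0 < e / (C + 1) by rewrite divr_gt0// ltr_wpDl.
have [] := @bounded_sum_tail R (fun k => `|triangular_coord k x| `^ r)
  (((C + 1) * `|x|) `^ r) _ _ ((e / (C + 1)) `^ r).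
- by move=> k; exact: powR_ge0.
- move=> n; rewrite -lq_norm_leP//; first exact: triangular_coord_lower.
  by rewrite mulr_ge0// addr_ge0.
- by rewrite powR_gt0.
move=> N tail; exists N => n Nn.
pose a k := if (k < N)%N then 0 else triangular_coord k x.
have -> : triangular_proj n x - triangular_proj N x = \sum_(k < n) a k *: s k.
  rewrite !triangular_projE.
  rewrite -!(big_mkord xpredT (fun k => triangular_coord k x *: s k)).
  rewrite -(big_mkord xpredT (fun k => a k *: s k)).
  rewrite (@big_cat_nat _ _ _ N 0 n)//= [RHS](@big_cat_nat _ _ _ N 0 n)//=.
  have -> : \sum_(0 <= k < N) a k *: s k = 0.
    rewrite big_nat_cond big1// => k /andP[/andP[_ kN] _].
    by rewrite /a kN scale0r.
  rewrite addrAC subrr !add0r.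
  by apply: eq_big_nat => k /andP[Nk _]; rewrite /a ltnNge Nk.
apply: le_trans (upper _ _) _.
apply: (@le_trans _ _ (C * (e / (C + 1)))).
  apply: ler_wpM2l => //; rewrite lq_norm_leP ?(ltW e'0)//.
  apply: le_trans (tail N n (leqnn N)).
  rewrite -(big_mkord xpredT (fun k => `|a k| `^ r)) (@big_cat_nat _ _ _ N 0 n)//=.
  have -> : \sum_(0 <= k < N) `|a k| `^ r = 0.
    rewrite big_nat_cond big1// => k /andP[/andP[_ kN] _].
    by rewrite /a kN normr0 powR0// gt_eqF.
  rewrite add0r.
  by apply: ler_sum_nat => k /andP[Nk _]; rewrite /a ltnNge Nk.
rewrite mulrA ler_pdivrMr ?ltr_wpDl// mulrC; apply: ler_wpM2l; first exact: ltW.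
by rewrite lerDl.
Qed.

(** The increasing projections converge strongly, to a bounded projection
    onto the closed span of the basic sequence. *)
Lemma triangular_complemented : exists Z : set X,
  [/\ Z `<=` Y, closed_inf_dim_subspace Z & complemented Z].
Proof.
pose P x := lim (triangular_proj n x @[n --> \oo]).
have Pl x : triangular_proj n x @[n --> \oo] --> P x by exact: triangular_proj_cvg.
have Plin : linear P.
  move=> a x y; apply: cvg_lim => //.
  under eq_fun do rewrite triangular_proj_linear.
  by apply: cvgD; [exact: (cvgZl_tmp (Pl x))|exact: Pl].
pose PL : {linear X -> X} := HB.pack P (GRing.isLinear.Build _ _ _ _ P Plin).
have Pc : continuous PL.
  apply: (@bounded_continuous _ _ _ PL (C * (C + 1))) => x.
  apply: (cvg_norm_le (Pl x)) => n.
  rewrite triangular_projE.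
  apply: le_trans (upper n (fun k => triangular_coord k x)) _.
  by rewrite -mulrA; apply: ler_wpM2l => //; exact: triangular_coord_lower.
have Ps l : P (s l) = s l.
  apply: cvg_lim => //; apply: cvg_near_cst; exists l.+1 => // n /= ln.
  by rewrite triangular_proj_basis ln.
have PP x : P (P x) = P x.
  have PPn n : P (triangular_proj n x) = triangular_proj n x.
    rewrite triangular_projE -[LHS]/(PL _) linear_sum; apply: eq_bigr => k _.
    by rewrite linearZ/= Ps.
  have PPl : P (triangular_proj n x) @[n --> \oo] --> P (P x).
    exact: (cvg_comp (fun n => triangular_proj n x) PL (Pl x) (Pc (P x))).
  have Pnl : P (triangular_proj n x) @[n --> \oo] --> P x.
    by under eq_fun do rewrite PPn; exact: Pl.
  by rewrite -[LHS](cvg_lim _ PPl)// -[RHS](cvg_lim _ Pnl).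
have [Y0 YZ YD YS] := submodP Ysub.
exists (range PL); split.
- move=> _ [x _ <-].
  refine (@closed_cvg _ _ \oo _ (fun n => triangular_proj n x) Y Ycl _ _ (Pl x)).
  apply: nearW => n; rewrite triangular_projE.
  by apply: (YS n (fun k => triangular_coord k x)) => k _.
- split.
  + split; first by apply/mem_set; exists 0 => //; rewrite linear0.
    move=> a u v /set_mem[x _ <-] /set_mem[y _ <-]; apply/mem_set.
    by exists (a *: x + y) => //; rewrite linearP.
  + have -> : range PL = (fun x => PL x - x) @^-1` [set 0].
      apply/seteqP; split=> [_ [x _ <-]/=|x /= /eqP]; first by rewrite PP subrr.
      by rewrite subr_eq0 => /eqP xE; exists x.
    apply: preimage_closed; last first.
      exact: (accessible_closed_set1 (hausdorff_accessible (@norm_hausdorff _ X))).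
    by move=> x _; apply: cvgB; [exact: Pc|exact: cvg_id].
  + pose g k : {linear X -> R} := HB.pack (triangular_coord k)
      (GRing.isLinear.Build _ _ _ _ (triangular_coord k : X -> R)
         (triangular_coord_linear k)).
    apply: (@biorthogonal_infinite_dim _ _ _ s g).
      by move=> k; exists (s k) => //; exact: Ps.
    exact: triangular_coord_basis.
- by exists PL; split => // _ [x _ <-]; exact: PP.
Qed.

End triangular_projection.

(** * The gliding hump *)

Section gliding_hump.
Context {R : realType} (X : completeNormedModType R).
Variables (Y : set X) (r C c : R).
Variables (B U : nat -> X -> X) (A V : X -> X).
Hypotheses (Ysub : submod_closed (mem Y)) (Ycl : closed Y).
Hypotheses (r1 : 1 <= r) (C0 : 0 <= C) (c0 : 0 < c).
Hypothesis Blin : forall N, linear (B N).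
Hypothesis BA : forall x, B N x @[N --> \oo] --> A x.
Hypothesis UV : forall x, U N x @[N --> \oo] --> V x.
(* Windows of [B] give functionals whose values are r-summable, hence the
   boundedness of the projection; windows of [U] say where the vectors live,
   hence the convergence of their r-summable combinations. *)
Hypothesis lower : forall N : nat -> nat, {homo N : m n / (m <= n)%N} ->
  forall n x,
    lq_norm r (fun k : 'I_n => `|B (N k.+1) x - B (N k) x|) <= C * `|x|.
Hypothesis upper : forall (N : nat -> nat) (s : nat -> X),
  {homo N : m n / (m <= n)%N} -> (forall k, `|s k| = 1) ->
  (forall k, `|U (N k) (s k)| <= 2^-1 ^+ k) ->
  (forall k, `|V (s k) - U (N k.+1) (s k)| <= 2^-1 ^+ k) ->
  forall n (a : nat -> R),
    `|\sum_(k < n) a k *: s k| <= C * lq_norm r (fun k : 'I_n => a k).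
Hypothesis norming : forall w : X, exists theta : {linear X -> R},
  (forall x, `|theta x| <= `|x|) /\ `|w| / 2 <= theta w.
Hypothesis hump : forall (Psi : seq {linear X -> R}) N (e : R), 0 < e ->
  exists x, [/\ Y x, `|x| = 1 & killed Psi x] /\
    [/\ c <= `|A x|, `|B N x| <= e & `|U N x| <= e].

Let D : R := 4 / c * C + C.

Let D0 : 0 <= D.
Proof. by rewrite addr_ge0// mulr_ge0// divr_ge0// ltW. Qed.

(* Chosen so that the errors of the first k humps in the k-th window stay
   summable after multiplication by the constants of the projection. *)
Let delta k : R :=
  Num.min (c / 4) (2^-1 ^+ k.+1 / ((D + 1) * (8 / c) * k.+1%:R)).

Let deltaD k : 0 < (D + 1) * (8 / c) * k.+1%:R.
Proof. by rewrite !mulr_gt0// ?invr_gt0// ltr_wpDl. Qed.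

Let delta0 k : 0 < delta k.
Proof.
rewrite /delta lt_min divr_gt0//= divr_gt0//.
Qed.

(* A choice consists of a hump, of its functional and of the end of its window;
   the window starts where the previous one ended. *)
Let T : Type := X * {linear X -> R} * nat.

Let start (f : nat -> T) k : nat := if k is k'.+1 then (f k').2 else 0%N.

Let G k (f : nat -> T) (t : T) : Prop :=
  [/\ Y t.1.1, `|t.1.1| = 1,
      forall l, (l < k)%N -> (f l).1.2 t.1.1 = 0,
      `|U (start f k) t.1.1| <= 2^-1 ^+ k &
      `|V t.1.1 - U t.2 t.1.1| <= 2^-1 ^+ k] /\
  [/\ (start f k <= t.2)%N, t.1.2 t.1.1 = 1,
      forall x, `|t.1.2 x| <= 4 / c * `|B t.2 x - B (start f k) x|,
      forall M, (t.2 <= M)%N -> `|A t.1.1 - B M t.1.1| <= delta k.+1 &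
      forall M, (t.2 <= M)%N -> forall l, (l < k)%N ->
        `|A (f l).1.1 - B M (f l).1.1| <= delta k.+1].

Let G_history k (f g : nat -> T) t :
  (forall i, (i < k)%N -> f i = g i) -> G k f t -> G k g t.
Proof.
move=> fg.
have E : start f k = start g k by case: k fg => //= k ->.
rewrite /G -E => -[[? ? H1 ? ?] [? ? ? ? H2]].
by split; [split=> // l lk|split=> // M tM l lk]; rewrite -fg//;
  [exact: H1|exact: H2].
Qed.

Let G_step k (f : nat -> T) :
  (forall i, (i < k)%N -> G i f (f i)) -> exists t, G k f t.
Proof.
move=> _; set N := start f k.
have e0 : 0 < Num.min (2^-1 ^+ k) (c / 4) :> R.
  by rewrite lt_min exprn_gt0 ?invr_gt0//= divr_gt0.
have [x [[Yx x1 kx] []]] := hump [seq (f l).1.2 | l <- iota 0 k] N e0.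
rewrite !le_min => cA /andP[_ BN] /andP[UN _].
have half0 : 0 < 2^-1 ^+ k :> R by rewrite exprn_gt0// invr_gt0.
have d0 := delta0 k.+1.
have nearB z : \forall M \near \oo, `|A z - B M z| <= delta k.+1.
  by have /cvgrPdist_le/(_ _ d0) := BA (x := z).
have nearU : \forall M \near \oo, `|V x - U M x| <= 2^-1 ^+ k.
  by have /cvgrPdist_le/(_ _ half0) := UV (x := x).
have nearH : \forall M \near \oo, forall l : 'I_k,
    `|A (f l).1.1 - B M (f l).1.1| <= delta k.+1.
  by apply: filter_forall => l; exact: nearB.
have [M1 _ HB] := nearB x.
have [M2 _ HU] := nearU.
have [M3 _ HH] := nearH.
pose M := maxn N (maxn M1 (maxn M2 M3)).
have NM : (N <= M)%N by rewrite leq_maxl.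
have M1M : (M1 <= M)%N by rewrite /M !leq_max leqnn ?orbT.
have M2M : (M2 <= M)%N by rewrite /M !leq_max leqnn ?orbT.
have M3M : (M3 <= M)%N by rewrite /M !leq_max leqnn ?orbT.
pose w := B M x - B N x.
have cw : c / 2 <= `|w|.
  have : `|A x| <= `|A x - B M x| + `|w| + `|B N x|.
    rewrite {1}(_ : A x = (A x - B M x) + w + B N x).
      by apply: le_trans (ler_normD _ _) _; rewrite lerD2r ler_normD.
    by rewrite /w addrA subrK subrK.
  have := HB M M1M; rewrite /= /delta le_min => /andP[BM _].
  by move: cA BN BM; lra.
have [theta [thb thw]] := norming w.
have thc : c / 4 <= theta w by move: cw thw; lra.
have th0 : 0 < theta w by apply: lt_le_trans thc; rewrite divr_gt0.
(* Normalized to be one on the hump; [norming] and the size of [w] give the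
   factor [4 / c] of its lower estimate. *)
pose p z : R := (theta w)^-1 * theta (B M z - B N z).
have plin : linear p.
  move=> a u v; rewrite /p !Blin opprD addrACA -scalerBr linearP.
  by rewrite mulrDr mulrCA.
pose phi : {linear X -> R} := HB.pack p (GRing.isLinear.Build _ _ _ _ p plin).
exists (x, phi, M); split; split => //=.
- by move=> l lk; move: kx; rewrite /killed all_map => /allP/(_ l);
    rewrite mem_iota/= => /(_ lk)/eqP.
- exact: HU.
- by rewrite /p mulVf// gt_eqF.
- move=> z; rewrite /p normrM; apply: ler_pM => //.
  rewrite gtr0_norm ?invr_gt0// -[leRHS]invf_div lef_pV2 ?posrE ?divr_gt0//.
- by move=> M' MM'; apply: HB; exact: leq_trans MM'.
- move=> M' MM' l lk; have := HH M' (leq_trans M3M MM').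
  by move=> /(_ (Ordinal lk)).
Qed.

(** Humps are chosen one after the other: each lives, up to a small error, in
    a window of [B] beyond those of its predecessors, so that functionals
    norming it there are almost biorthogonal. *)
Lemma gliding_hump : exists Z : set X,
  [/\ Z `<=` Y, closed_inf_dim_subspace Z & complemented Z].
Proof.
have [f fG] := @history_choice T (0, \0 : {linear X -> R}, 0%N) G G_history G_step.
pose s k := (f k).1.1; pose phi k := (f k).1.2; pose N := start f.
have Nhom : {homo N : m n / (m <= n)%N}.
  apply: homo_leq => [//|? ? ?|k]; first exact: leq_trans.
  by have [_ []] := fG k.
have C1D : 4 / c * C <= D by rewrite lerDl.
have C2D : C <= D by rewrite lerDr mulr_ge0// divr_ge0// ltW.
apply: (@triangular_complemented _ X s phi _ _ Y r D) => //.
- by move=> k; have [_ []] := fG k.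
- by move=> l k lk; have [[_ _ H _ _] _] := fG k; exact: H.
- by move=> k; have [[]] := fG k.
- move=> n x; apply: (@le_trans _ _ (4 / c * (C * `|x|))); last first.
    by rewrite mulrA ler_wpM2r.
  have c40 : 0 <= 4 / c by rewrite divr_ge0// ltW.
  apply: le_trans (ler_wpM2l c40 (lower Nhom n x)).
  rewrite -[X in _ <= X * _](ger0_norm c40).
  rewrite -(lq_normZ _ (fun k : 'I_n => `|B (N k.+1) x - B (N k) x|) r1).
  apply: le_lq_norm => // k.
  by rewrite normrM normr_id ger0_norm//; have [_ [_ _ H _ _]] := fG k.
- move=> n a; apply: (@le_trans _ _ (C * lq_norm r (fun k : 'I_n => a k))).
    apply: (@upper N) => // k.
    + by have [[]] := fG k.
    + by have [[]] := fG k.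
    + by have [[]] := fG k.
  by apply: ler_wpM2r => //; exact: lq_norm_ge0.
move=> [|k]; first by rewrite big_ord0 mulr0 exprn_ge0// invr_ge0.
have near l M : (l < k.+1)%N -> (N k.+1 <= M)%N ->
    `|A (s l) - B M (s l)| <= delta k.+1.
  have [_ [_ _ _ H1 H2]] := fG k; rewrite ltnS leq_eqVlt => /predU1P[->|lk] NM.
    exact: H1.
  exact: H2.
have phis l : (l < k.+1)%N -> `|phi k.+1 (s l)| <= 8 / c * delta k.+1.
  move=> lk; have [_ [_ _ H _ _]] := fG k.+1.
  apply: le_trans (H (s l)) _; rewrite (_ : 8 / c = 4 / c * 2); last by lra.
  rewrite -[leRHS]mulrA; apply: ler_wpM2l; first by rewrite divr_ge0// ltW.
  rewrite (_ : B _ _ - _ = (A (s l) - B (start f k.+1) (s l))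
                         - (A (s l) - B (f k.+1).2 (s l))); last first.
    by rewrite opprB [RHS]addrC addrA subrK.
  apply: le_trans (ler_normB _ _) _; rewrite mulrDl mul1r; apply: lerD.
    exact: near.
  by apply: near => //; exact: (Nhom k.+1 k.+2).
have dle : delta k.+1 <= 2^-1 ^+ k.+2 / ((D + 1) * (8 / c) * k.+2%:R).
  by rewrite /delta ge_min lexx orbT.
move: dle; rewrite ler_pdivlMr// => dle; apply: le_trans dle.
have -> : delta k.+1 * ((D + 1) * (8 / c) * k.+2%:R)
    = (D + 1) * (k.+2%:R * (8 / c * delta k.+1)).
  rewrite [LHS]mulrC -!mulrA; congr (_ * _).
  by rewrite [RHS]mulrCA; congr (_ * _); rewrite [RHS]mulrCA.
apply: ler_wpM2l; first by rewrite addr_ge0.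
apply: (@le_trans _ _ (\sum_(l < k.+1) 8 / c * delta k.+1)).
  by apply: ler_sum => l _; exact: phis.
rewrite sumr_const card_ord -[leLHS]mulr_natl.
apply: ler_wpM2r; last by rewrite ler_nat.
by rewrite mulr_ge0// ?divr_ge0// ltW.
Qed.

End gliding_hump.

(** * Truncations in the sequence space l_q *)

Section at_most_one.
Context {R : realType}.

Lemma at_most_one_nonzero n (b : 'I_n -> R) :
  (forall k l, k != l -> b k = 0 \/ b l = 0) ->
  (forall k, b k = 0) \/ exists k, forall l, l != k -> b l = 0.
Proof.
move=> b0; have [|no] := pselect (exists k, b k != 0); last first.
  by left=> k; apply/eqP/negPn/negP => bk; apply: no; exists k.
move=> [k bk]; right; exists k => l lk; have [//|/eqP] := b0 l k lk.
by rewrite (negPf bk).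
Qed.

Lemma sum_at_most_one n (b : 'I_n -> R) (B : R) : 0 <= B ->
  (forall k, b k <= B) -> (forall k l, k != l -> b k = 0 \/ b l = 0) ->
  \sum_(k < n) b k <= B.
Proof.
move=> B0 bB /at_most_one_nonzero[b0|[k bk]]; first by rewrite big1.
by rewrite (bigD1 k)//= big1 ?addr0.
Qed.

Lemma powR_sum_at_most_one n (b : 'I_n -> R) (q : R) : 0 < q ->
  (forall k l, k != l -> b k = 0 \/ b l = 0) ->
  `|\sum_(k < n) b k| `^ q <= \sum_(k < n) `|b k| `^ q.
Proof.
move=> q0 /at_most_one_nonzero[b0|[k bk]].
  rewrite big1// normr0 powR0 ?gt_eqF//.
  by apply: sumr_ge0 => k _; exact: powR_ge0.
rewrite (bigD1 k)//= big1 ?addr0// [leRHS](bigD1 k)//= lerDl.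
by apply: sumr_ge0 => l _; exact: powR_ge0.
Qed.

End at_most_one.

#[local] Arguments lq_space_fun : simpl never.

Section lq_truncation.
Context {R : realType} {q : R} (q1 : 1 <= q).
Local Notation lq := (lq_space q1).
Local Notation mu := (counting : {measure set nat -> \bar R}).

Let q0 : 0 < q. Proof. exact: lt_le_trans q1. Qed.

Lemma lq_spaceD (u v : lq) j :
  lq_space_fun (u + v) j = lq_space_fun u j + lq_space_fun v j.
Proof. by []. Qed.

Lemma lq_spaceZ (a : R) (u : lq) j :
  lq_space_fun (a *: u) j = a * lq_space_fun u j.
Proof. by []. Qed.

Lemma lq_space_ext (u v : lq) :
  (forall j, lq_space_fun u j = lq_space_fun v j) -> u = v.
Proof. by move=> uv; apply/LfuneqP => j; exact: uv. Qed.

Lemma lq_space_sum_le (u : lq) n :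
  \sum_(j < n) `|lq_space_fun u j| `^ q <= `|u| `^ q.
Proof. by rewrite -lq_norm_leP//; exact: lq_norm_le_space. Qed.

Lemma lq_space_norm_leP (u : lq) (B : R) : 0 <= B ->
  (forall n, \sum_(j < n) `|lq_space_fun u j| `^ q <= B `^ q) -> `|u| <= B.
Proof.
move=> B0 uB; rewrite -lee_fin [(`|u|)%:E](lq_space_normE u).
by apply: Lnorm_counting_le => // n; rewrite lq_norm_leP.
Qed.

Lemma restr_Lfun (E : pred nat) (u : lq) :
  (fun j => if E j then lq_space_fun u j else 0) \in Lfun mu q%:E.
Proof.
rewrite inE; apply/andP; split; first by rewrite inE.
rewrite inE /= /finite_norm; apply: le_lt_trans (ltry `|u|).
apply: Lnorm_counting_le => // n; rewrite lq_norm_leP//.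
apply: le_trans (lq_space_sum_le u n); apply: ler_sum => j _.
by case: ifP => // _; rewrite normr0 powR0 ?powR_ge0// gt_eqF.
Qed.

Definition restr (E : pred nat) (u : lq) : lq :=
  Lfun_Sub (ge1_EFin q1) (restr_Lfun E u).

#[local] Arguments restr : simpl never.

Lemma restrE (E : pred nat) (u : lq) j :
  lq_space_fun (restr E u) j = if E j then lq_space_fun u j else 0.
Proof. by []. Qed.

Lemma restr_linear (E : pred nat) : linear (restr E).
Proof.
move=> a u v; apply: lq_space_ext => j.
rewrite lq_spaceD lq_spaceZ !restrE.
by case: ifP => // _; rewrite mulr0 addr0.
Qed.

Lemma restr_norm_le (E : pred nat) (u : lq) : `|restr E u| <= `|u|.
Proof.
apply: lq_space_norm_leP => // n.
apply: le_trans (lq_space_sum_le u n); apply: ler_sum => j _.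
by rewrite restrE; case: ifP => // _; rewrite normr0 powR0 ?powR_ge0// gt_eqF.
Qed.

Lemma restr_support_norm (E : pred nat) L (u : lq) :
  (forall j, E j -> (j < L)%N) ->
  `|restr E u| `^ q <= \sum_(j < L) `|lq_space_fun (restr E u) j| `^ q.
Proof.
move=> EL; have s0 := sum_powR_ge0 (fun j : 'I_L => lq_space_fun (restr E u) j) q.
rewrite -[leRHS](powRVK q0 s0) powR_ler ?powR_ge0//.
apply: lq_space_norm_leP => [|n]; first exact: powR_ge0.
rewrite powRVK//.
have [nL|/ltnW Ln] := leqP n L.
  rewrite -!(big_mkord xpredT (fun j => `|lq_space_fun (restr E u) j| `^ q)).
  rewrite [leRHS](@big_cat_nat _ _ _ n)//= lerDl.
  by apply: sumr_ge0 => j _; exact: powR_ge0.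
rewrite -!(big_mkord xpredT (fun j => `|lq_space_fun (restr E u) j| `^ q)).
rewrite (@big_cat_nat _ _ _ L)//= -[leRHS]addr0 lerD2l.
rewrite big_nat_cond big1// => j /andP[/andP[Lj _] _].
rewrite restrE; case: ifP => [/EL|_]; first by rewrite ltnNge Lj.
by rewrite normr0 powR0// gt_eqF.
Qed.

Lemma restr_pred1_norm j (u : lq) : `|restr (pred1 j) u| <= `|lq_space_fun u j|.
Proof.
rewrite -(powR_ler q0)//.
apply: le_trans (@restr_support_norm _ j.+1 _ _) _ => [i /eqP ->//|].
rewrite big_ord_recr/= restrE /= eqxx big1 ?add0r// => i _.
by rewrite restrE /= ltn_eqF// normr0 powR0// gt_eqF.
Qed.

Lemma restr_cvg (u : lq) : restr (fun j => (j < N)%N) u @[N --> \oo] --> u.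
Proof.
apply/cvgrPdist_le => e e0.
have [] := @bounded_sum_tail R (fun j => `|lq_space_fun u j| `^ q)
  (`|u| `^ q) _ _ (e `^ q).
- by move=> j; exact: powR_ge0.
- by move=> n; exact: lq_space_sum_le.
- by rewrite powR_gt0.
move=> N tail; exists N => // M /= NM.
have E j : lq_space_fun (u - restr (fun j => (j < M)%N) u) j =
    if (j < M)%N then 0 else lq_space_fun u j.
  rewrite -scaleN1r lq_spaceD lq_spaceZ restrE.
  by case: ifP => _; rewrite ?mulr0 ?addr0// mulN1r subrr.
apply: lq_space_norm_leP => [|n]; first exact: ltW.
apply: le_trans (tail M n NM).
under eq_bigr do rewrite E.
rewrite -(big_mkord xpredT (fun j => `|if (j < M)%N then 0 else lq_space_fun u j| `^ q)).
have [nM|/ltnW Mn] := leqP n M.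
  rewrite [leRHS]big_geq// big_nat_cond big1// => j /andP[/andP[_ jn] _].
  by rewrite (leq_trans jn nM) normr0 powR0// gt_eqF.
rewrite (@big_cat_nat _ _ _ M)//= -[leRHS]add0r; apply: lerD.
  rewrite big_nat_cond big1// => j /andP[/andP[_ jM] _].
  by rewrite jM normr0 powR0// gt_eqF.
by apply: ler_sum_nat => j /andP[Mj _]; rewrite ltnNge Mj.
Qed.

Lemma restr_windowE M N (u : lq) : (M <= N)%N ->
  restr (fun j => (M <= j < N)%N) u =
  restr (fun j => (j < N)%N) u - restr (fun j => (j < M)%N) u.
Proof.
move=> MN; apply: lq_space_ext => j.
rewrite -[X in _ + X]scaleN1r lq_spaceD lq_spaceZ !restrE leqNgt.
have [jM|_] := ltnP j M; last by rewrite mulr0 addr0.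
by rewrite (leq_trans jM MN) mulN1r subrr.
Qed.

Section windows.
Variables (N : nat -> nat) (Nhom : {homo N : m n / (m <= n)%N}).
Local Notation window k := (fun j => (N k <= j < N k.+1)%N).

Lemma window_disjoint (k l j : nat) : k != l ->
  ~~ ((N k <= j < N k.+1) && (N l <= j < N l.+1))%N.
Proof.
move=> kl; apply/negP => /andP[/andP[k1 k2] /andP[l1 l2]].
move: kl; rewrite neq_ltn => /orP[kl|lk].
  by have := leq_trans k2 (leq_trans (Nhom kl) l1); rewrite ltnn.
by have := leq_trans l2 (leq_trans (Nhom lk) k1); rewrite ltnn.
Qed.

Lemma restr_window_lower n (u : lq) :
  \sum_(k < n) `|restr (window k) u| `^ q <= `|u| `^ q.
Proof.
apply: le_trans (lq_space_sum_le u (N n)).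
apply: (@le_trans _ _ (\sum_(k < n) \sum_(j < N n)
    `|lq_space_fun (restr (window k) u) j| `^ q)).
  apply: ler_sum => k _; apply: restr_support_norm => j /andP[_ jk].
  by apply: leq_trans jk (Nhom _).
rewrite exchange_big; apply: ler_sum => j _ /=.
apply: sum_at_most_one => [|k|k l kl]; first exact: powR_ge0.
  by rewrite restrE; case: ifP => // _; rewrite normr0 powR0 ?powR_ge0// gt_eqF.
rewrite !restrE; have := window_disjoint j kl.
by rewrite negb_and => /orP[/negPf ->|/negPf ->]; [left|right];
  rewrite normr0 powR0// gt_eqF.
Qed.

Lemma restr_window_upper n (w : nat -> lq) :
  `|\sum_(k < n) restr (window k) (w k)| `^ q <= \sum_(k < n) `|w k| `^ q.
Proof.
have s0 := sum_powR_ge0 (fun k : 'I_n => `|w k|) q.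
under [leRHS]eq_bigr do rewrite -[`|_|]normr_id.
rewrite -[leRHS](powRVK q0 s0) powR_ler ?powR_ge0//.
apply: lq_space_norm_leP => [|m]; first exact: powR_ge0.
rewrite powRVK//.
apply: (@le_trans _ _ (\sum_(j < m) \sum_(k < n)
    `|lq_space_fun (restr (window k) (w k)) j| `^ q)).
  apply: ler_sum => j _.
  have -> : lq_space_fun (\sum_(k < n) restr (window k) (w k)) j =
      \sum_(k < n) lq_space_fun (restr (window k) (w k)) j.
    elim/big_ind2 : _ => // x1 x2 y1 y2 <- <-; exact: lq_spaceD.
  apply: powR_sum_at_most_one => // k l kl.
  rewrite !restrE; have := window_disjoint j kl.
  by rewrite negb_and => /orP[/negPf ->|/negPf ->]; [left|right].
rewrite exchange_big; apply: ler_sum => k _ /=; rewrite normr_id.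
apply: le_trans (lq_space_sum_le _ _) _.
by rewrite powR_ler//; exact: restr_norm_le.
Qed.

End windows.

End lq_truncation.

(** * Multiplication and weak norms in C(K), and the space of summing operators *)

Section continuous_multiplication.
Context {R : realType} {K : topologicalType} {cK : compact [set: K]}.
Local Notation CK := (continuous_functions R cK).

Definition cfun (f : K -> R) (h : continuous f) : CK :=
  ContinuousFunction cK (mem_set (h : [set f : K -> R | continuous f] f)).

Lemma cfun_ext (f g : CK) : (forall x, f x = g x) -> f = g.
Proof. by move=> fg; apply/val_inj/funext. Qed.

Lemma cfunD (f g : CK) x : (f + g) x = f x + g x.
Proof. by []. Qed.

Lemma cfunN (f : CK) x : (- f) x = - f x.
Proof. by []. Qed.

Lemma cfunZ a (f : CK) x : (a *: f) x = a * f x.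
Proof. by []. Qed.

Lemma cfun_sum n (f : 'I_n -> CK) x : (\sum_(i < n) f i) x = \sum_(i < n) f i x.
Proof. by elim/big_ind2 : _ => // u a v b <- <-. Qed.

Lemma cfun_norm_ub (f : CK) x : `|f x| <= `|f|.
Proof. exact: sup_norm_ub. Qed.

Lemma cfun_norm_le (f : CK) M : 0 <= M -> (forall x, `|f x| <= M) -> `|f| <= M.
Proof. exact: sup_norm_le. Qed.

Lemma mulc_continuous (h f : CK) : continuous (fun x => h x * f x).
Proof.
move=> x.
exact: (cvgM (@continuous_functionsP _ _ _ h x) (@continuous_functionsP _ _ _ f x)).
Qed.

Definition mulc (h f : CK) : CK := cfun (@mulc_continuous h f).

Lemma mulcE h f x : mulc h f x = h x * f x.
Proof. by []. Qed.

Lemma cstc_continuous (a : R) : continuous (fun _ : K => a).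
Proof. by move=> x; exact: cvg_cst. Qed.

Definition cstc (a : R) : CK := cfun (@cstc_continuous a).

Definition eval_at (x : K) (f : CK) : R := f x.

Lemma eval_at_linear x : linear (eval_at x : CK -> R).
Proof. by move=> a f g. Qed.

Variables (p : R) (p1 : 1 <= p).
Let p0 : 0 < p. Proof. exact: lt_le_trans p1. Qed.

Lemma le_weak_norm n (f : 'I_n -> CK) x :
  lq_norm p (fun i => f i x) <= weak_norm p f.
Proof.
pose d : {linear CK -> R} := HB.pack (eval_at x)
  (GRing.isLinear.Build _ _ _ _ (eval_at x : CK -> R) (eval_at_linear x)).
by apply: (weak_norm_ub p1 f (phi := d)) => g; exact: cfun_norm_ub.
Qed.

(** Functionals of norm one are tested through finite-dimensional duality:
    [sum_i b_i phi(f_i)] is the value of [phi] at one function, whose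
    supremum norm is a pointwise quantity. *)
Lemma weak_norm_le n (f : 'I_n -> CK) B : 0 <= B ->
  (forall x, lq_norm p (fun i => f i x) <= B) -> weak_norm p f <= B.
Proof.
move=> B0 fB; apply: ge_sup.
  by eexists; exists (\0 : {linear CK -> R}); [exact: dual_ball0|].
move=> _ [phi phib <-].
have [b [bE bB]] := root_sum_dual (fun i => phi (f i)) p1.
rewrite /lq_norm -bE.
have -> : \sum_i b i * phi (f i) = phi (\sum_i b i *: f i).
  by rewrite linear_sum; apply: eq_bigr => i _; rewrite linearZ.
apply: le_trans (ler_norm _) _; apply: le_trans (phib _) _.
apply: cfun_norm_le => // x; rewrite cfun_sum.
exact: le_trans (bB (fun i => f i x)) (fB x).
Qed.

End continuous_multiplication.
Arguments cstc {R K} cK a.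

Section summing_basics.
Context {R : realType} {X Y : normedModType R}.
Variables (p q : R) (p1 : 1 <= p) (pq : p <= q).
Let q1 : 1 <= q := le_trans p1 pq.
Local Notation Pi := (summing_operators X Y p1 pq).

Lemma Pi_ext (S T : Pi) : (forall f, S f = T f) -> S = T.
Proof. by move=> ST; apply/val_inj/funext. Qed.

Lemma PiD (S T : Pi) f : (S + T) f = S f + T f. Proof. by []. Qed.
Lemma PiN (S : Pi) f : (- S) f = - S f. Proof. by []. Qed.
Lemma PiZ a (S : Pi) f : (a *: S) f = a *: S f. Proof. by []. Qed.

Lemma Pi_sum n (S : 'I_n -> Pi) f : (\sum_(i < n) S i) f = \sum_(i < n) S i f.
Proof. by elim/big_ind2 : _ => // u a v b <- <-. Qed.

Lemma Pi_linear (S : Pi) : linear S.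
Proof. by case: (summing_operatorP S). Qed.

Lemma Pi_eval0 (S : Pi) : S 0 = 0.
Proof.
have := Pi_linear S 1 0 0; rewrite !scale1r addr0 => S0.
by apply: (@addrI _ (S 0)); rewrite -S0 addr0.
Qed.

Lemma Pi_norm (S : Pi) f : `|S f| <= `|S| * `|f|.
Proof. exact: (summing_bound_le p1 q1 (summing_operator_bound S)). Qed.

Lemma Pi_norm_le (S : Pi) C : summing_bound q p S C -> `|S| <= C.
Proof. exact: summing_norm_lb. Qed.

Lemma summing_predP (T : X -> Y) C : linear T -> summing_bound q p T C ->
  T \in summing_pred q p.
Proof.
move=> Tlin TC; apply/mem_set; split=> //; last by exists C.
pose TL : {linear X -> Y} := HB.pack T (GRing.isLinear.Build _ _ _ _ T Tlin).
by apply: (@bounded_continuous _ _ _ TL C) => x; exact: (summing_bound_le p1 q1).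
Qed.

Lemma Pi_cvg_eval (S : nat -> Pi) (T : Pi) f :
  S n @[n --> \oo] --> T -> (S n : Pi) f @[n --> \oo] --> T f.
Proof.
move=> ST; apply/cvgrPdist_le => e e0.
have d0 : 0 < e / (`|f| + 1) by rewrite divr_gt0// ltr_wpDl.
have /cvgrPdist_le/(_ _ d0) := ST; apply: filterS => n Sn.
rewrite -[T f - S n f]/((T - S n) f); apply: le_trans (Pi_norm _ _) _.
apply: le_trans (ler_wpM2r (normr_ge0 f) Sn) _.
by rewrite mulrAC ler_pdivrMr ?ltr_wpDl// ler_wpM2l ?(ltW e0)// lerDl.
Qed.

End summing_basics.

(** * Summing operators composed with multiplications *)

Section summing_on_functions.
Context {R : realType} {K : topologicalType} {cK : compact [set: K]}.
Context {Y : completeNormedModType R}.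
Variables (p q : R) (p1 : 1 <= p) (pq : p <= q).
Let q1 : 1 <= q := le_trans p1 pq.
Let p0 : 0 < p. Proof. exact: lt_le_trans p1. Qed.
Let q0 : 0 < q. Proof. exact: lt_le_trans q1. Qed.
Local Notation CK := (continuous_functions R cK).
Local Notation Pi := (summing_operators CK Y p1 pq).

(** On C(K) the weak p-norm of a family is the supremum over points of the
    p-norm of its values, so this is the unit ball of the weak norm; any finite
    index type is allowed in order to merge families. *)
Definition unit_family (J : finType) (f : J -> CK) : Prop :=
  forall x, \sum_j `|f j x| `^ p <= 1.

Lemma unit_family_le1 (J : finType) (f : J -> CK) j x :
  unit_family f -> `|f j x| <= 1.
Proof.
move=> /(_ x) f1; rewrite -(powR_ler p0)// powR1.
apply: le_trans f1; rewrite (bigD1 j)//= lerDl.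
by apply: sumr_ge0 => i _; exact: powR_ge0.
Qed.

Lemma summing_unit_family (S : Pi) (J : finType) (f : J -> CK) :
  unit_family f -> \sum_j `|S (f j)| `^ q <= `|S| `^ q.
Proof.
move=> f1; pose g (i : 'I_#|J|) := f (enum_val i).
have reix (F : J -> R) : \sum_j F j = \sum_(i < #|J|) F (enum_val i).
  by rewrite (reindex _ (onW_bij _ (enum_val_bij J))).
have w1 : weak_norm p g <= 1.
  apply: weak_norm_le => // x; rewrite lq_norm_leP// powR1.
  by rewrite -(reix (fun j => `|f j x| `^ p)).
have [_ /(_ _ g) Sg] := summing_operator_bound S.
rewrite (reix (fun j => `|S (f j)| `^ q)).
under eq_bigr do rewrite -[`|S _|]normr_id.
rewrite -lq_norm_leP//; apply: le_trans Sg _.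
by rewrite ler_piMr// summing_norm_ge0.
Qed.

Lemma unit_family_summing (T : CK -> Y) C : linear T -> 0 <= C ->
  (forall n (f : 'I_n -> CK), unit_family f ->
    \sum_i `|T (f i)| `^ q <= C `^ q) -> summing_bound q p T C.
Proof.
move=> Tlin C0 TC; split=> // n f.
pose TL : {linear CK -> Y} := HB.pack T (GRing.isLinear.Build _ _ _ _ T Tlin).
have := weak_norm_ge0 p1 f; rewrite le_eqVlt => /predU1P[w0|w0].
  rewrite -w0 mulr0 lq_norm_leP// big1 ?powR_ge0// => i _.
  have -> : f i = 0.
    apply: cfun_ext => x; apply/normr0_eq0/le_anti; rewrite normr_ge0 andbT.
    apply: le_trans (ler_norm_root_sum (fun i => f i x) i p0) _.
    by have := le_weak_norm p1 f x; rewrite -w0.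
  by rewrite -[T 0]/(TL 0) linear0 !normr0 powR0// gt_eqF.
set w := weak_norm p f in w0 *.
have g1 : unit_family (fun i => w^-1 *: f i).
  move=> x; have := le_weak_norm p1 f x; rewrite lq_norm_leP ?(ltW w0)// => fw.
  under eq_bigr do rewrite cfunZ normrM powRM// ger0_norm ?invr_ge0 ?(ltW w0)//.
  rewrite -mulr_sumr; apply: le_trans (ler_wpM2l (powR_ge0 _ _) fw) _.
  by rewrite -powRM ?invr_ge0 ?(ltW w0)// mulVf ?gt_eqF// powR1.
have := TC _ _ g1; under eq_bigr do rewrite -[`|T _|]normr_id.
rewrite -lq_norm_leP// => Tg.
have -> : (fun i => `|T (f i)|) = (fun i => w * `|T (w^-1 *: f i)|).
  apply/funext => i; rewrite -[T (_ *: _)]/(TL _) linearZ normrZ.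
  by rewrite ger0_norm ?invr_ge0 ?(ltW w0)// mulrA mulfV ?gt_eqF// mul1r.
rewrite (lq_normZ w (fun i => `|T (w^-1 *: f i)|) q1) (gtr0_norm w0) mulrC.
by apply: ler_wpM2r => //; exact: ltW.
Qed.

(** In terms of q-th powers, so that the defects of several families add up. *)
Lemma near_norming_family (S : Pi) e : 0 < e ->
  exists n (f : 'I_n -> CK), unit_family f /\
    `|S| `^ q - e <= \sum_i `|S (f i)| `^ q.
Proof.
move=> e0; apply: contrapT => no.
have lt n (f : 'I_n -> CK) : unit_family f ->
    \sum_i `|S (f i)| `^ q < `|S| `^ q - e.
  by move=> f1; rewrite ltNge; apply/negP => Se; apply: no; exists n, f.
have t0 : 0 <= `|S| `^ q - e.
  have /lt/ltW : unit_family (fun _ : 'I_0 => (0 : CK)).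
    by move=> x; rewrite big_ord0.
  by rewrite big_ord0.
have := @unit_family_summing S ((`|S| `^ q - e) `^ q^-1) (Pi_linear S)
  (powR_ge0 _ _) _.
have SB n (f : 'I_n -> CK) : unit_family f ->
    \sum_i `|S (f i)| `^ q <= ((`|S| `^ q - e) `^ q^-1) `^ q.
  by move=> /lt/ltW; rewrite powRVK.
move=> /(_ SB)/Pi_norm_le; rewrite -(powR_ler q0) ?powR_ge0// powRVK//.
by rewrite leNgt ltrBlDr ltrDl e0.
Qed.

Lemma comp_mulc_bound (S : Pi) (h : CK) :
  summing_bound q p (fun f => S (mulc h f)) (`|S| * `|h|).
Proof.
split; first exact: mulr_ge0.
move=> n f; have [_ /(_ _ (fun i => mulc h (f i))) Sf] := summing_operator_bound S.
apply: le_trans Sf _; rewrite -mulrA; apply: ler_wpM2l.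
  exact: summing_norm_ge0.
have w0 := weak_norm_ge0 p1 f.
apply: weak_norm_le => // [|x]; first exact: mulr_ge0.
apply: (@le_trans _ _ (`|h| * lq_norm p (fun i => f i x))).
  rewrite -[X in _ <= X * _](normr_id h) -(lq_normZ _ (fun i => f i x) p1).
  apply: le_lq_norm => // i.
  rewrite mulcE !normrM normr_id; apply: ler_wpM2r => //.
  exact: cfun_norm_ub.
by apply: ler_wpM2l => //; exact: le_weak_norm.
Qed.

Lemma comp_mulc_linear (S : Pi) (h : CK) : linear (fun f => S (mulc h f)).
Proof.
move=> a f g; rewrite -Pi_linear; congr (summing_fun S _).
by apply: cfun_ext => x; rewrite !(mulcE, cfunD, cfunZ) mulrDr mulrCA.
Qed.

Definition comp_mulc (h : CK) (S : Pi) : Pi :=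
  SummingOperator p1 pq
    (summing_predP p1 pq (@comp_mulc_linear S h) (@comp_mulc_bound S h)).

Lemma comp_mulcE h S f : comp_mulc h S f = S (mulc h f). Proof. by []. Qed.

Lemma comp_mulc_norm h S : `|comp_mulc h S| <= `|S| * `|h|.
Proof. exact/Pi_norm_le/comp_mulc_bound. Qed.

Lemma comp_mulcP a h S T : comp_mulc h (a *: S + T) = a *: comp_mulc h S + comp_mulc h T.
Proof. by apply: Pi_ext => f. Qed.

Lemma comp_mulc_mulc h g S : comp_mulc h (comp_mulc g S) = comp_mulc (mulc g h) S.
Proof.
apply: Pi_ext => f; rewrite !comp_mulcE; congr (summing_fun S _).
by apply: cfun_ext => x; rewrite !mulcE mulrA.
Qed.

Lemma comp_mulcD h g S : comp_mulc (h + g) S = comp_mulc h S + comp_mulc g S.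
Proof.
apply: Pi_ext => f; rewrite PiD !comp_mulcE.
have := Pi_linear S 1 (mulc h f) (mulc g f); rewrite !scale1r => <-.
congr (summing_fun S _); apply: cfun_ext => x.
by rewrite cfunD !mulcE cfunD mulrDl.
Qed.

Lemma comp_mulcN h S : comp_mulc (- h) S = - comp_mulc h S.
Proof.
apply/eqP; rewrite -addr_eq0 -comp_mulcD addNr; apply/eqP/Pi_ext => f.
rewrite comp_mulcE -[RHS](Pi_eval0 S); congr (summing_fun S _).
by apply: cfun_ext => x; rewrite mulcE mul0r.
Qed.

Lemma comp_mulc_cst1 S : comp_mulc (cstc cK 1) S = S.
Proof.
apply: Pi_ext => f; rewrite comp_mulcE; congr (summing_fun S _).
by apply: cfun_ext => x; rewrite mulcE mul1r.
Qed.

(** Near-norming families for the operators [S o M_(h k)] can be glued into a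
    single admissible family: multiplying them by the [h k] keeps the
    pointwise p-norm bounded because the [h k] share the unit mass. *)
Lemma comp_mulc_lower (S : Pi) n (h : 'I_n -> CK) :
  (forall x, \sum_k `|h k x| <= 1) ->
  lq_norm q (fun k => `|comp_mulc (h k) S|) <= `|S|.
Proof.
move=> h1; rewrite lq_norm_leP//; apply/ler_addgt0Pr => e e0.
under eq_bigr do rewrite normr_id.
have d0 : 0 < e / n.+1%:R by rewrite divr_gt0.
have /choice[fam famP] : forall k : 'I_n, exists F : {m : nat & 'I_m -> CK},
    unit_family (projT2 F) /\ `|comp_mulc (h k) S| `^ q - e / n.+1%:R <=
      \sum_i `|comp_mulc (h k) S (projT2 F i)| `^ q.
  move=> k; have [m [f [f1 fS]]] := near_norming_family (comp_mulc (h k) S) d0.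
  by exists (existT _ m f).
pose J := {k : 'I_n & 'I_(projT1 (fam k))}.
have sumJ (F : forall k : 'I_n, 'I_(projT1 (fam k)) -> R) :
    \sum_(j : J) F (tag j) (tagged j) = \sum_k \sum_i F k i.
  by rewrite (sig_big_dep xpredT (fun=> xpredT) F).
pose G (j : J) : CK := mulc (h (tag j)) (projT2 (fam (tag j)) (tagged j)).
have G1 : unit_family G.
  move=> x.
  rewrite (sumJ (fun k i => `|mulc (h k) (projT2 (fam k) i) x| `^ p)).
  apply: le_trans (h1 x); apply: ler_sum => k _.
  have hk1 : `|h k x| <= 1.
    apply: le_trans (h1 x); rewrite (bigD1 k)//= lerDl.
    by apply: sumr_ge0.
  under eq_bigr do rewrite mulcE normrM powRM//.
  rewrite -mulr_sumr; have [fk1 _] := famP k.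
  apply: (@le_trans _ _ (`|h k x| `^ p)).
    by apply: ler_piMr; [exact: powR_ge0|exact: fk1].
  have [->|hk0] := eqVneq `|h k x| 0; first by rewrite powR0// gt_eqF.
  apply: ge1r_powR => //; rewrite hk1 andbT lt_def hk0 /=; exact: normr_ge0.
have := summing_unit_family S G1.
rewrite (sumJ (fun k i => `|S (mulc (h k) (projT2 (fam k) i))| `^ q)) => SG.
apply: (@le_trans _ _ (\sum_(k < n) (\sum_i `|S (mulc (h k) (projT2 (fam k) i))| `^ q
    + e / n.+1%:R))).
  by apply: ler_sum => k _; rewrite -lerBlDr; case: (famP k).
rewrite big_split/=; apply: lerD => //.
rewrite sumr_const card_ord -[leLHS]mulr_natl mulrCA ler_piMr ?(ltW e0)//.
by rewrite ler_pdivrMr// mul1r ler_nat.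
Qed.

End summing_on_functions.

(** * Cutoffs and ideals on scattered metrizable spaces *)

Lemma countable_setU T (A B : set T) :
  countable A -> countable B -> countable (A `|` B).
Proof.
move=> cA cB; apply: (@sub_countable _ _ _
    (\bigcup_(b in [set: bool]) if b then A else B)).
  by apply: subset_card_le => x [Ax|Bx]; [exists true|exists false].
by apply: bigcup_countable => // -[].
Qed.

(** The metric is bundled with its axioms so that the cutoffs, and the operators
    built from them, depend on a single parameter. *)
Record compatible_metric (R : realType) (K : topologicalType) :=
  CompatibleMetric {
    dist :> K -> K -> R ;
    dist_eq0 : forall x y, dist x y = 0 <-> x = y ;
    dist_sym : forall x y, dist x y = dist y x ;
    dist_tri : forall x y z, dist x z <= dist x y + dist y z ;
    dist_nbhs : forall x (A : set K),
      nbhs x A <-> exists2 e : R, 0 < e & [set y | dist x y < e] `<=` A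
  }.

Section cutoffs.
Context {R : realType} {K : topologicalType} {cK : compact [set: K]}.
Local Notation CK := (continuous_functions R cK).

Lemma mulcC (h g : CK) : mulc h g = mulc g h.
Proof. by apply: cfun_ext => x; rewrite !mulcE mulrC. Qed.

Variable d : compatible_metric R K.
Let d_eq0 := dist_eq0 d.
Let d_sym := dist_sym d.
Let d_tri := dist_tri d.
Let d_nbhs := dist_nbhs d.

Lemma dist_ge0 x y : 0 <= d x y.
Proof.
have := d_tri x y x; rewrite (d_sym y x) (d_eq0 x x).2//.
by rewrite -mulr2n pmulrn_lge0.
Qed.

Lemma dist_gt0 x y : x <> y -> 0 < d x y.
Proof.
by move=> xy; rewrite lt_def dist_ge0 andbT; apply/eqP => /d_eq0.
Qed.

Lemma dist_continuous x : continuous (d x).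
Proof.
move=> y; apply/cvgrPdist_le => e e0; apply/d_nbhs; exists e => // z /= yz.
rewrite ler_norml; have := d_tri x z y; have := d_tri x y z.
by rewrite (d_sym z y); lra.
Qed.

(** Equal to one up to distance [1 / k] and to zero from distance [2 / k] on;
    constantly one for [k = 0]. *)
Definition cutoff_fun k x y : R := Num.min 1 (Num.max 0 (2 - k%:R * d x y)).

Lemma cutoff_continuous k x : continuous (cutoff_fun k x).
Proof.
move=> y; apply: (@continuous_min R K (cst 1)).
  exact: cst_continuous.
apply: (@continuous_max R K (cst 0)); first exact: cst_continuous.
apply: cvgB; first exact: cvg_cst.
by apply: cvgM; [exact: cvg_cst|exact: dist_continuous].
Qed.

Definition cutoff k x : CK := cfun (@cutoff_continuous k x).

Lemma cutoffE k x y : cutoff k x y = Num.min 1 (Num.max 0 (2 - k%:R * d x y)).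
Proof. by []. Qed.

Lemma cutoff_ge0 k x y : 0 <= cutoff k x y.
Proof. by rewrite cutoffE le_min ler01 le_max lexx. Qed.

Lemma cutoff_le1 k x y : cutoff k x y <= 1.
Proof. by rewrite cutoffE ge_min lexx. Qed.

Lemma cutoff_norm k x : `|cutoff k x| <= 1.
Proof. by apply: cfun_norm_le => // y; rewrite ger0_norm ?cutoff_le1 ?cutoff_ge0. Qed.

Lemma cutoff_decr k l x y : (k <= l)%N -> cutoff l x y <= cutoff k x y.
Proof.
move=> kl; rewrite !cutoffE le_min ge_min lexx /= ge_min; apply/orP; right.
rewrite ge_max !le_max lexx /=; apply/orP; right.
by rewrite lerD2l lerN2 ler_wpM2r ?dist_ge0// ler_nat.
Qed.

Lemma cutoff_center k x : cutoff k x x = 1.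
Proof.
rewrite cutoffE (d_eq0 x x).2// mulr0 subr0.
by rewrite max_r// min_l// ler1n.
Qed.

Lemma cutoff_neq0 k x y : cutoff k x y != 0 -> k%:R * d x y < 2.
Proof.
apply: contraNT; rewrite -leNgt => kd; rewrite cutoffE.
by rewrite max_l ?min_r// subr_le0.
Qed.

Lemma cutoff_lt1 k x y : cutoff k x y < 1 -> 1 < k%:R * d x y.
Proof.
apply: contraTT; rewrite -!leNgt => kd; rewrite cutoffE.
rewrite le_min lexx /= le_max; apply/orP; right; lra.
Qed.

Lemma cutoff_far x y : x <> y -> exists N, forall k, (N <= k)%N -> cutoff k x y = 0.
Proof.
move=> /dist_gt0 xy; exists (Num.bound (2 / d x y)) => k Nk.
apply/eqP; apply: contraT => /cutoff_neq0.
rewrite -ltr_pdivlMr// => /(le_lt_trans _).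
have : (Num.bound (2 / d x y))%:R <= k%:R :> R by rewrite ler_nat.
move=> /[swap]/[apply]; rewrite ltNge => /negP[].
by apply: ltW; apply: archi_boundP; rewrite divr_ge0// ltW.
Qed.

Lemma cutoff_radius e : 0 < e ->
  exists N, forall k x y, (N <= k)%N -> k%:R * d x y <= 2 -> d x y < e.
Proof.
move=> e0; exists (Num.bound (2 / e)) => k x y Nk kd.
have : 2 / e < k%:R.
  apply: lt_le_trans (_ : (Num.bound (2 / e))%:R <= _); last by rewrite ler_nat.
  by apply: archi_boundP; rewrite divr_ge0// ltW.
rewrite ltr_pdivrMr// => ke.
have k0 : 0 < k%:R :> R.
  by rewrite -(pmulr_lgt0 _ e0); apply: lt_trans ke.
by rewrite -(ltr_pM2l k0); exact: le_lt_trans kd ke.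
Qed.

Section ideals.
Variable I : set CK.
Hypothesis I0 : I 0.
Hypothesis ID : forall h g, I h -> I g -> I (h + g).
Hypothesis IM : forall h g, I h -> I (mulc h g).

(** Compactness yields one element of the ideal that is positive on [C];
    [g] is then a multiple of it. The filter of all sets containing every large
    element of the ideal replaces the choice of a finite subcover. *)
Lemma ideal_of_support (C : set K) (g : CK) : closed C ->
  (forall y, ~ C y -> g y = 0) ->
  (forall y, C y -> exists h, I h /\ h y != 0) -> I g.
Proof.
move=> Ccl gC IC.
have /compact_near_coveringP Ccov : compact C.
  by apply: subclosed_compact cK _ => //.
pose F : set_system CK := [set A | exists s, [/\ I s, forall y, 0 <= s y &
  forall t : CK, I t -> (forall y, s y <= t y) -> A t]].
have FF : Filter F.
  split.
  - by exists 0.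
  - move=> A B [s [Is s0 sA]] [t [It t0 tB]]; exists (s + t); split.
    + exact: ID.
    + by move=> y; rewrite cfunD addr_ge0.
    + move=> u Iu stu; split; [apply: sA => // y|apply: tB => // y];
        apply: le_trans (stu y); rewrite cfunD; [rewrite lerDl|rewrite lerDr];
        [exact: t0|exact: s0].
  - by move=> A B AB [s [Is s0 sA]]; exists s; split=> // t It st; exact/AB/sA.
have [] := Ccov CK F (fun s y => 0 < s y) FF.
  move=> y /IC[h [Ih hy]].
  exists ([set z | h z != 0], [set t : CK | forall z, mulc h h z <= t z]).
    split; last first.
      exists (mulc h h); split=> //; first exact: IM.
      by move=> z; rewrite mulcE -expr2 sqr_ge0.
    have hc := @continuous_functionsP _ _ _ h y.
    exact: (@cvgr_neq0 _ _ _ _ _ (h : K -> R) _ hc hy).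
  move=> [z t] /= [hz ht]; apply: lt_le_trans (ht z).
  by rewrite -expr2 lt_def sqrf_eq0 hz sqr_ge0.
move=> s [Is s0 /(_ s Is (fun y => lexx (s y))) /= spos].
have gs_cont : continuous (fun y => g y / s y).
  move=> y; have [Cy|nCy] := pselect (C y).
    apply: cvgM; first exact: continuous_functionsP.
    by apply: cvgV; [rewrite gt_eqF// spos|exact: continuous_functionsP].
  have gy0 : g y / s y = 0 by rewrite gC// mul0r.
  rewrite /continuous_at gy0; apply: cvg_near_cst.
  have : nbhs y (~` C) by apply: open_nbhs_nbhs; split=> //; exact: closed_openC.
  by apply: filterS => z nCz; rewrite gC// mul0r.
have -> : g = mulc s (cfun gs_cont); last exact: IM.
apply: cfun_ext => y; rewrite mulcE.
have [Cy|nCy] := pselect (C y).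
  by rewrite /= mulrC divfK// gt_eqF// spos.
by rewrite /= gC// mul0r mulr0.
Qed.

(** The common zeros of a proper ideal form a nonempty compact set. Let [x] be an
    isolated point of it. Functions supported close to [x] and vanishing around
    [x] are in the ideal, in particular the differences of narrow cutoffs; if
    these force a cutoff at [x] into the ideal, then [x] is not a zero. *)
Lemma scattered_ideal (sK : scattered K) :
  (forall x m, (forall k, (m <= k)%N -> I (cutoff m x - cutoff k x)) -> I (cutoff m x)) ->
  I (cstc cK 1).
Proof.
move=> Icut; pose Z : set K := [set x | forall h, I h -> h x = 0].
have [Z0|nZ] := pselect (Z !=set0); last first.
  apply: (@ideal_of_support setT) => [||y _]; [exact: closedT|by move=> y []|].
  apply: contrapT => no; apply: nZ; exists y => h Ih.
  by apply/eqP/negPn/negP => hy; apply: no; exists h.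
have Zcl : closed Z.
  have -> : Z = \bigcap_(h in I) ((h : K -> R) @^-1` [set 0]) by [].
  apply: closed_bigI => h _; apply: preimage_closed; last first.
    exact: (accessible_closed_set1 (hausdorff_accessible (@norm_hausdorff _ R^o))).
  by move=> x _; exact: continuous_functionsP.
have Zc : compact Z by exact: (subclosed_compact Zcl cK).
have [x [/set_mem Zx [V /d_nbhs[e e0 eV] VZ]]] := sK Z Zc Z0.
have [m mP] := cutoff_radius e0.
have Im : I (cutoff m x).
  apply: Icut => k mk.
  pose C := [set y | 1 <= k%:R * d x y] `&` [set y | m%:R * d x y <= 2].
  have dc (j : nat) : continuous (fun y => j%:R * d x y).
    by move=> y; apply: cvgM; [exact: cvg_cst|exact: dist_continuous].
  apply: (@ideal_of_support C).
  - apply: closedI.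
      by apply: (@preimage_closed K R _ [set t | 1 <= t]) => [y _|];
        [exact: dc|exact: closed_ge].
    by apply: (@preimage_closed K R _ [set t | t <= 2]) => [y _|];
      [exact: dc|exact: closed_le].
  - move=> y nCy; rewrite cfunD cfunN; apply/eqP; rewrite subr_eq0 eq_sym.
    have := cutoff_decr x y mk; rewrite le_eqVlt => /predU1P[->//|kltm].
    exfalso; apply: nCy; split=> /=.
      by apply/ltW/cutoff_lt1; apply: lt_le_trans kltm (cutoff_le1 _ _ _).
    apply/ltW/cutoff_neq0; rewrite gt_eqF//.
    exact: le_lt_trans (cutoff_ge0 _ _ _) kltm.
  - move=> y [kdy mdy]; apply: contrapT => no.
    have Zy : Z y.
      by move=> h Ih; apply/eqP/negPn/negP => hy; apply: no; exists h.
    have dy : d x y < e.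
      exact: mP (leqnn m) mdy.
    have : (V `&` Z) y by split=> //; exact: eV.
    rewrite VZ => xy; move: kdy => /=; rewrite xy (d_eq0 x x).2// mulr0.
    by rewrite ler10.
have := Zx _ Im; rewrite cutoff_center => /eqP; rewrite oner_eq0//.
Qed.

End ideals.

(** The ideal of functions with countable support passes the test. *)
Lemma scattered_countable : scattered K -> countable [set: K].
Proof.
move=> sK; pose I : set CK := [set h | countable [set y | h y != 0]].
have: I (cstc cK 1).
  apply: (scattered_ideal _ _ _ sK).
  - rewrite /I /= (_ : [set y | _] = set0); first exact: countable0.
    by apply/seteqP; split=> // y /=; rewrite eqxx.
  - move=> h g Ih Ig; apply: (@sub_countable _ _ _
        ([set y | h y != 0] `|` [set y | g y != 0])).
      apply: subset_card_le => y hgy; have : (h + g) y != 0 := hgy.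
      by rewrite cfunD; have [->|h0] := eqVneq (h y) 0; [rewrite add0r; right|left].
    by apply: countable_setU.
  - move=> h g Ih; apply: sub_countable Ih; apply: subset_card_le => y hgy.
    have : mulc h g y != 0 := hgy; rewrite mulcE.
    by apply: contraNN => /eqP ->; rewrite mul0r.
  move=> x m Ik; apply: (@sub_countable _ _ _ ([set x] `|`
    \bigcup_(k in [set k | (m <= k)%N]) [set y | (cutoff m x - cutoff k x) y != 0])).
    apply: subset_card_le => y /= my.
    have [->|xy] := pselect (x = y); [by left|right].
    have [N Nk] := cutoff_far xy; set k := maxn m N; exists k; first exact: leq_maxl.
    suff: (cutoff m x - cutoff k x) y != 0 by [].
    by rewrite cfunD cfunN (Nk k) ?leq_maxr// subr0.
  apply: countable_setU; first exact: countable1.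
  by apply: bigcup_countable => // k mk; exact: Ik.
by apply: sub_countable; apply: subset_card_le => y _ /=; rewrite oner_eq0.
Qed.

End cutoffs.

(** * Atoms of a summing operator *)

Section bounded_maps.
Context {R : realType} {X Y : normedModType R}.

Lemma cvg_bounded_linear (L : X -> Y) (B : R) (u : nat -> X) (l : X) :
  linear L -> (forall x, `|L x| <= B * `|x|) -> u @ \oo --> l ->
  L (u n) @[n --> \oo] --> L l.
Proof.
move=> Llin LB ul.
pose LL : {linear X -> Y} := HB.pack L (GRing.isLinear.Build _ _ _ _ L Llin).
exact: (cvg_comp u LL ul (@bounded_continuous _ _ _ LL B LB l)).
Qed.

Lemma linearP0 (L : X -> Y) : linear L ->
  [/\ L 0 = 0, {morph L : x y / x + y}, forall a, {morph L : x / a *: x},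
      {morph L : x y / x - y} &
      forall n (u : 'I_n -> X), L (\sum_(i < n) u i) = \sum_(i < n) L (u i)].
Proof.
move=> Llin.
pose LL : {linear X -> Y} := HB.pack L (GRing.isLinear.Build _ _ _ _ L Llin).
split; first exact: (linear0 LL).
- exact: (linearD LL).
- by move=> a x; exact: (linearZZ LL).
- exact: (linearB LL).
- by move=> n u; exact: (linear_sum LL).
Qed.

End bounded_maps.

Section atoms.
Context {R : realType} {K : topologicalType} {cK : compact [set: K]}.
Context {Y : completeNormedModType R}.
Variables (p q : R) (p1 : 1 <= p) (pq : p <= q).
Let q1 : 1 <= q := le_trans p1 pq.
Let p0 : 0 < p. Proof. exact: lt_le_trans p1. Qed.
Let q0 : 0 < q. Proof. exact: lt_le_trans q1. Qed.
Local Notation CK := (continuous_functions R cK).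
Local Notation Pi := (summing_operators CK Y p1 pq).

Lemma comp_mulc_linearS (h : CK) : linear (comp_mulc h : Pi -> Pi).
Proof. by move=> a S T; exact: comp_mulcP. Qed.

Lemma comp_mulcB (h g : CK) (S : Pi) :
  comp_mulc h S - comp_mulc g S = comp_mulc (h - g) S.
Proof. by rewrite comp_mulcD comp_mulcN. Qed.

Variable d : compatible_metric R K.
Local Notation cut k x := (@cutoff R K cK d k x).

(** Otherwise infinitely many differences of cutoffs would have images
    bounded away from zero, although together they have unit mass. *)
Lemma comp_cut_cvg (x : K) (S : Pi) :
  cvg (comp_mulc (cut k x) S @[k --> \oo]).
Proof.
apply: norm_cauchy_seq => e e0; apply: contrapT => no.
have /choice[g gP] : forall N, exists n, (N <= n)%N /\
    e < `|comp_mulc (cut n x) S - comp_mulc (cut N x) S|.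
  move=> N; apply: contrapT => noN; apply: no; exists N => n Nn.
  by rewrite leNgt; apply/negP => en; apply: noN; exists n.
pose N i := iter i g 0%N.
pose h i : CK := cut (N i.+1) x - cut (N i) x.
have hE i y : `|h i y| = cut (N i) x y - cut (N i.+1) x y.
  rewrite /h cfunD cfunN distrC ger0_norm// subr_ge0.
  by apply: cutoff_decr => //; exact: (gP (N i)).1.
have hsum n y : \sum_(i < n) `|h i y| <= 1.
  suff -> : \sum_(i < n) `|h i y| = cut 0 x y - cut (N n) x y.
    have := cutoff_le1 (cK := cK) d 0 x y.
    have := cutoff_ge0 (cK := cK) d (N n) x y; lra.
  elim: n => [|n IH]; first by rewrite big_ord0 subrr.
  by rewrite big_ord_recr/= IH hE addrA subrK.
have Se n : n%:R * e `^ q <= `|S| `^ q.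
  have := @comp_mulc_lower _ _ _ _ _ _ p1 pq S n (fun i => h i) (hsum n).
  rewrite lq_norm_leP//; apply: le_trans.
  rewrite mulr_natl -[n in _ *+ n]card_ord -sumr_const; apply: ler_sum => i _.
  rewrite powR_ler// ?(ltW e0)// normr_id /h -comp_mulcB.
  exact: ltW (gP (N i)).2.
have eq0 : 0 < e `^ q by rewrite powR_gt0.
have := Se (Num.bound (`|S| `^ q / e `^ q)).
rewrite -ler_pdivlMr// leNgt => /negP; apply.
by apply: archi_boundP; rewrite divr_ge0 ?powR_ge0.
Qed.

Definition atom (x : K) (S : Pi) : Pi :=
  lim (comp_mulc (cut k x) S @[k --> \oo]).

Lemma atom_cvg x S : comp_mulc (cut k x) S @[k --> \oo] --> atom x S.
Proof. exact: comp_cut_cvg. Qed.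

Lemma atom_linear x : linear (atom x).
Proof.
move=> a S T; apply: cvg_lim => //; under eq_fun do rewrite comp_mulc_linearS.
by apply: cvgD; [exact: (cvgZl_tmp (@atom_cvg x S))|exact: atom_cvg].
Qed.

Lemma atom_norm x S : `|atom x S| <= `|S|.
Proof.
apply: (cvg_norm_le (@atom_cvg x S)) => n; apply: le_trans (comp_mulc_norm _ _) _.
by rewrite ler_piMr//; apply: cutoff_norm.
Qed.

Lemma cut_cst_cvg x (f : CK) :
  mulc (cut k x) (f - cstc cK (f x)) @[k --> \oo] --> (0 : CK).
Proof.
apply/cvgrPdist_le => e e0.
have fc := @continuous_functionsP _ _ _ f x.
have /cvgrPdist_le/(_ _ e0)/(dist_nbhs d)[r r0 rf] := fc.
have [N NP] := cutoff_radius d r0.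
exists N => // k /= Nk; rewrite sub0r normrN.
apply: cfun_norm_le => [|y]; first exact: ltW.
rewrite mulcE normrM cfunD cfunN.
have [->|cy] := eqVneq (cut k x y) 0; first by rewrite normr0 mul0r ltW.
have dy : d x y < r by apply: (NP k) => //; apply/ltW/cutoff_neq0; exact: cy.
have := rf y dy; rewrite /= distrC => fy.
apply: le_trans fy; apply: ler_piMl => //.
rewrite ger0_norm; [exact: cutoff_le1|exact: cutoff_ge0].
Qed.

(** Multiplied by narrow cutoffs around [x], the functions [f] and [f x] become
    indistinguishable. *)
Lemma atomE x S f : atom x S f = f x *: atom x S (cstc cK 1).
Proof.
have h1 := Pi_cvg_eval (f := f) (@atom_cvg x S).
have h2 := Pi_cvg_eval (f := cstc cK 1) (@atom_cvg x S).
have h3 : (comp_mulc (cut k x) S : Pi) f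
    - f x *: (comp_mulc (cut k x) S : Pi) (cstc cK 1) @[k --> \oo] -->
    atom x S f - f x *: atom x S (cstc cK 1).
  by apply: cvgB => //; exact: (cvgZl_tmp h2).
have h4 : (comp_mulc (cut k x) S : Pi) f
    - f x *: (comp_mulc (cut k x) S : Pi) (cstc cK 1) @[k --> \oo] --> (0 : Y).
  have := cvg_bounded_linear (Pi_linear S) (Pi_norm S) (@cut_cst_cvg x f).
  rewrite Pi_eval0; apply: cvg_trans; apply: near_eq_cvg; apply: nearW => k.
  have [_ _ SZ SB _] := linearP0 (Pi_linear S).
  rewrite !comp_mulcE -SZ -SB; congr (summing_fun S _).
  apply: cfun_ext => y; rewrite !(cfunD, cfunN, cfunZ, mulcE) /=.
  by rewrite mulrBr mulr1 [_ * f x]mulrC.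
have := cvg_lim (@norm_hausdorff _ Y) h3.
rewrite (cvg_lim (@norm_hausdorff _ Y) h4) => /(_ _)/esym/eqP.
by rewrite subr_eq0 => /eqP.
Qed.

Lemma atom_comp_mulc x h S : atom x (comp_mulc h S) = comp_mulc h (atom x S).
Proof.
apply: cvg_lim => //.
have := cvg_bounded_linear (comp_mulc_linearS h)
  (B := `|h|) _ (@atom_cvg x S).
under eq_fun do rewrite comp_mulc_mulc mulcC -comp_mulc_mulc.
by apply => T; rewrite mulrC; exact: comp_mulc_norm.
Qed.

Lemma atom_value_norm x S : `|atom x S (cstc cK 1)| <= `|S|.
Proof.
have c1 : `|cstc cK (1 : R)| <= 1 by apply: cfun_norm_le => // y; rewrite normr1.
apply: le_trans (Pi_norm _ _) _; rewrite -[leRHS]mulr1.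
exact: (ler_pM (normr_ge0 _) (normr_ge0 _) (atom_norm x S) c1).
Qed.

Lemma comp_mulc_atom h x S : comp_mulc h (atom x S) = h x *: atom x S.
Proof.
apply: Pi_ext => f; rewrite comp_mulcE PiZ atomE [in RHS]atomE mulcE.
by rewrite scalerA.
Qed.

Lemma atom_idem x S : atom x (atom x S) = atom x S.
Proof.
apply: cvg_lim => //; apply: cvg_near_cst; apply: nearW => k.
by rewrite comp_mulc_atom cutoff_center scale1r.
Qed.

Lemma atom_ortho x y S : x <> y -> atom y (atom x S) = 0.
Proof.
move=> xy; apply: cvg_lim => //.
have [N NP] := cutoff_far (cK := cK) d (not_eq_sym xy).
apply: cvg_near_cst; exists N => // k /= Nk.
by rewrite comp_mulc_atom NP// scale0r.
Qed.

End atoms.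

(** * Enumerating the atoms *)

Section enumerated_atoms.
Context {R : realType} {K : topologicalType} {cK : compact [set: K]}.
Context {Y : completeNormedModType R}.
Variables (p q : R) (p1 : 1 <= p) (pq : p <= q).
Let q1 : 1 <= q := le_trans p1 pq.
Let p0 : 0 < p. Proof. exact: lt_le_trans p1. Qed.
Let q0 : 0 < q. Proof. exact: lt_le_trans q1. Qed.
Local Notation CK := (continuous_functions R cK).
Local Notation Pi := (summing_operators CK Y p1 pq).

(** The values of an admissible family at [x] are at most one in absolute value,
    so their q-th powers are below their p-th powers, as [p <= q]. *)
Lemma rank_one_norm (S : Pi) x (v : Y) :
  (forall f, S f = f x *: v) -> `|S| <= `|v|.
Proof.
move=> SE; apply: Pi_norm_le; apply: unit_family_summing => //.
  exact: Pi_linear.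
move=> n f f1; under eq_bigr do rewrite SE normrZ powRM//.
rewrite -mulr_suml ler_piMl ?powR_ge0//; apply: le_trans (f1 x).
apply: ler_sum => i _; have := unit_family_le1 p1 i x f1.
have [->|fi0] := eqVneq `|f i x| 0; first by rewrite !powR0// gt_eqF.
by move=> fi1; apply: ger_powR => //; rewrite fi1 andbT lt_def fi0 /= normr_ge0.
Qed.

Variables (d : compatible_metric R K) (num : K -> nat).
Hypothesis num_inj : injective num.
Local Notation cut k x := (@cutoff R K cK d k x).

(** An enumeration with gaps, which covers finite and empty [K] alike. *)
Definition nth_point i : option K :=
  if pselect (exists x, num x = i) is left h then Some (projT1 (cid h)) else None.

Lemma nth_point_num x : nth_point (num x) = Some x.
Proof.
rewrite /nth_point; case: pselect => [h|[]]; last by exists x.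
by congr Some; apply: num_inj; case: (cid h).
Qed.

Lemma num_nth_point i x : nth_point i = Some x -> num x = i.
Proof.
by rewrite /nth_point; case: pselect => // h [<-]; case: (cid h).
Qed.

Definition nth_cutoff k i : CK := if nth_point i is Some x then cut k x else 0.

Definition nth_atom i (S : Pi) : Pi :=
  if nth_point i is Some x then atom d x S else 0.

Lemma comp_mulc0 (S : Pi) : comp_mulc 0 S = 0.
Proof. by rewrite -[0 in LHS](subrr 0) -comp_mulcB subrr. Qed.

Lemma nth_atom_cvg i S :
  comp_mulc (nth_cutoff k i) S @[k --> \oo] --> nth_atom i S.
Proof.
rewrite /nth_cutoff /nth_atom; case: nth_point => [x|]; first exact: atom_cvg.
by under eq_fun do rewrite comp_mulc0; exact: cvg_cst.
Qed.

Lemma nth_atom_linear i : linear (nth_atom i).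
Proof.
rewrite /nth_atom; case: nth_point => [x|]; first exact: atom_linear.
by move=> a S T; rewrite scaler0 addr0.
Qed.

Lemma nth_atom_comp_mulc i h S :
  nth_atom i (comp_mulc h S) = comp_mulc h (nth_atom i S).
Proof.
rewrite /nth_atom; case: nth_point => [x|]; first exact: atom_comp_mulc.
by have [-> _ _ _ _] := linearP0 (@comp_mulc_linearS _ _ _ Y _ _ p1 pq h).
Qed.

(** Finitely many distinct points have disjoint cutoffs as soon as these are
    narrower than half of the smallest distance. *)
Lemma nth_cutoff_disjoint N : \forall k \near \oo, forall i j : 'I_N,
  i != j -> forall y, nth_cutoff k i y = 0 \/ nth_cutoff k j y = 0.
Proof.
apply: filter_forall => i; apply: filter_forall => j.
have [<-|ij] := eqVneq i j; first by apply: nearW => k.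
rewrite /nth_cutoff; case Ei: (nth_point i) => [x|]; last first.
  by apply: nearW => k _ y; left.
case Ej: (nth_point j) => [x'|]; last by apply: nearW => k _ y; right.
have xx' : x <> x'.
  move=> E; move: ij; rewrite -val_eqE /= -(num_nth_point Ei) E.
  by rewrite (num_nth_point Ej) eqxx.
have r0 : 0 < d x x' / 2 by rewrite divr_gt0//; exact: dist_gt0.
have [M MP] := cutoff_radius d r0.
exists M => // k /= Mk _ y.
have [cx0|cx] := eqVneq (cut k x y) 0; [by left|right].
apply: contrapT => /eqP h; have {h} cx' : cut k x' y != 0 := h.
have := MP k x y Mk (ltW (cutoff_neq0 cx)).
have := MP k x' y Mk (ltW (cutoff_neq0 cx')).
have := dist_tri d x y x'; rewrite (dist_sym d y x'); lra.
Qed.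

Lemma nth_cutoff_sum N : \forall k \near \oo, forall y,
  \sum_(i < N) `|nth_cutoff k i y| <= 1.
Proof.
apply: filterS (nth_cutoff_disjoint N) => k dis y.
apply: sum_at_most_one => // [i|i j ij].
  rewrite /nth_cutoff; case: nth_point => [x|]; last by rewrite normr0.
  by apply: le_trans (cfun_norm_ub _ _) (cutoff_norm _ _ _).
by have [->|->] := dis i j ij y; rewrite normr0; [left|right].
Qed.

Definition atoms_upto N (S : Pi) : Pi := \sum_(i < N) nth_atom i S.

Lemma atoms_upto_linear N : linear (atoms_upto N).
Proof.
move=> a S T; rewrite /atoms_upto scaler_sumr -big_split /=.
by apply: eq_bigr => i _; rewrite nth_atom_linear.
Qed.

Lemma atoms_upto_comp_mulc N h S :
  atoms_upto N (comp_mulc h S) = comp_mulc h (atoms_upto N S).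
Proof.
have [_ _ _ _ ->] := linearP0 (@comp_mulc_linearS _ _ _ Y _ _ p1 pq h).
by apply: eq_bigr => i _; rewrite nth_atom_comp_mulc.
Qed.

Lemma atoms_upto_atom N x S : (num x < N)%N -> atoms_upto N (atom d x S) = atom d x S.
Proof.
move=> xN; rewrite /atoms_upto (bigD1 (Ordinal xN))//= big1 => [|i ix].
  by rewrite /nth_atom nth_point_num atom_idem addr0.
rewrite /nth_atom; case E: nth_point => [y|//]; apply: atom_ortho => xy.
by move: ix; rewrite -val_eqE /= -(num_nth_point E) xy eqxx.
Qed.

Lemma window_sum (V : nmodType) (F : nat -> V) (N : nat -> nat) n :
  {homo N : m n / (m <= n)%N} ->
  \sum_(k < n) \sum_(N k <= i < N k.+1) F i = \sum_(N 0%N <= i < N n) F i.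
Proof.
move=> Nhom; elim: n => [|n IH]; first by rewrite big_ord0 big_geq.
by rewrite big_ord_recr/= IH -big_cat_nat ?Nhom.
Qed.

Lemma window_cutoff_cvg a b S :
  comp_mulc (\sum_(a <= i < b) nth_cutoff k i) S @[k --> \oo] -->
  \sum_(a <= i < b) nth_atom i S.
Proof.
elim: b => [|b IH].
  by under eq_fun do rewrite big_geq// comp_mulc0; rewrite big_geq//; exact: cvg_cst.
have [ab|ba] := leqP a b; last first.
  by under eq_fun do rewrite big_geq// comp_mulc0; rewrite big_geq//; exact: cvg_cst.
rewrite big_nat_recr//=; under eq_fun do rewrite big_nat_recr//= comp_mulcD.
by apply: cvgD => //; exact: nth_atom_cvg.
Qed.

(** For narrow cutoffs the sums over disjoint windows share the unit mass, so
    [comp_mulc_lower] applies, and the estimate passes to the limit. *)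
Lemma atoms_upto_lower (N : nat -> nat) n S : {homo N : m n / (m <= n)%N} ->
  lq_norm q (fun k : 'I_n => `|atoms_upto (N k.+1) S - atoms_upto (N k) S|)
  <= `|S|.
Proof.
move=> Nhom.
have E (k : nat) : atoms_upto (N k.+1) S - atoms_upto (N k) S =
    \sum_(N k <= i < N k.+1) nth_atom i S.
  rewrite /atoms_upto -!(big_mkord xpredT (fun i => nth_atom i S)).
  by rewrite (@big_cat_nat _ _ _ (N k) 0)//= ?Nhom// addrAC subrr add0r.
under eq_fun do rewrite E.
apply: (@lq_norm_lim _ q n _ \oo (fun m k =>
  `|comp_mulc (\sum_(N k <= i < N k.+1) nth_cutoff m i) S|)) => //.
  by move=> k; apply: cvg_norm; exact: window_cutoff_cvg.
apply: filterS (nth_cutoff_sum (N n)) => m m1.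
apply: (comp_mulc_lower S) => y; apply: le_trans (m1 y).
have fs a b : (\sum_(a <= i < b) nth_cutoff m i) y =
    \sum_(a <= i < b) nth_cutoff m i y.
  by elim/big_ind2 : _ => // u1 u2 v1 v2 <- <-.
apply: (@le_trans _ _ (\sum_(k < n) \sum_(N k <= i < N k.+1) `|nth_cutoff m i y|)).
  by apply: ler_sum => k _; rewrite fs; exact: ler_norm_sum.
rewrite window_sum// -(big_mkord xpredT (fun i => `|nth_cutoff m i y|)).
rewrite [leRHS](@big_cat_nat _ _ _ (N 0%N))//= ?Nhom// lerDr.
by apply: sumr_ge0.
Qed.

Lemma atoms_upto_norm N S : `|atoms_upto N S| <= `|S|.
Proof.
(* A single window, from [0] to [N]. *)
have Mhom : {homo (fun k => if k is 0 then 0 else N)%N : m n / (m <= n)%N}.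
  by move=> [|m] [|n].
have := atoms_upto_lower 1 S Mhom.
rewrite (lq_norm1 _ q1) normr_id; apply: le_trans.
have -> : atoms_upto 0 S = 0 by rewrite /atoms_upto big_ord0.
by rewrite subr0.
Qed.

End enumerated_atoms.

(** * Rows of a summing operator *)

Section lq_valued.
Context {R : realType} {K : topologicalType} {cK : compact [set: K]}.
Variables (p q : R) (p1 : 1 <= p) (pq : p <= q).
Let q1 : 1 <= q := le_trans p1 pq.
Let q0 : 0 < q. Proof. exact: lt_le_trans q1. Qed.
Local Notation CK := (continuous_functions R cK).
Local Notation lq := (lq_space (le_trans p1 pq)).
Local Notation Pi := (summing_operators CK lq p1 pq).

Lemma restr_comp_bound (E : pred nat) (S : Pi) :
  summing_bound q p (fun f => restr E (S f)) `|S|.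
Proof.
have [S0 SB] := summing_operator_bound S; split; first exact: normr_ge0.
move=> n f.
apply: le_trans (SB n f); apply: le_lq_norm => // i.
by rewrite !normr_id; exact: restr_norm_le.
Qed.

Lemma restr_comp_linear (E : pred nat) (S : Pi) :
  linear (fun f => restr E (S f)).
Proof. by move=> a f g; rewrite Pi_linear restr_linear. Qed.

Definition rows (E : pred nat) (S : Pi) : Pi :=
  SummingOperator p1 pq
    (summing_predP p1 pq (@restr_comp_linear E S) (@restr_comp_bound E S)).

Lemma rowsE E S f : rows E S f = restr E (S f). Proof. by []. Qed.

Lemma rows_norm E S : `|rows E S| <= `|S|.
Proof. exact/Pi_norm_le/restr_comp_bound. Qed.

Lemma rows_linear E : linear (rows E).
Proof. by move=> a S T; apply: Pi_ext => f; rewrite rowsE restr_linear. Qed.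

Lemma rows_comp_mulc E h S : rows E (comp_mulc h S) = comp_mulc h (rows E S).
Proof. by apply: Pi_ext => f. Qed.

Lemma rows_window M N S : (M <= N)%N ->
  rows (fun j => (j < N)%N) S - rows (fun j => (j < M)%N) S
  = rows (fun j => (M <= j < N)%N) S.
Proof. by move=> MN; apply: Pi_ext => f; rewrite rowsE restr_windowE. Qed.

Lemma rows_split N S :
  rows (fun j => (j < N)%N) S = \sum_(j < N) rows (pred1 (j : nat)) S.
Proof.
elim: N => [|N IH].
  by rewrite big_ord0; apply: Pi_ext => f; apply: lq_space_ext => j.
rewrite big_ord_recr/= -IH; apply: Pi_ext => f; apply: lq_space_ext => j.
rewrite PiD lq_spaceD !rowsE !restrE ltnS leq_eqVlt /=.
by case: ltngtP => _; rewrite ?addr0 ?add0r.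
Qed.

(** On one function this is disjointness of supports in l_q; it survives
    summation over an admissible family because both sides are q-th powers. *)
Lemma rows_window_upper (N : nat -> nat) n (S : nat -> Pi) (B : R) :
  {homo N : m n / (m <= n)%N} -> 0 <= B ->
  \sum_(k < n) `|S k| `^ q <= B `^ q ->
  `|\sum_(k < n) rows (fun j => (N k <= j < N k.+1)%N) (S k)| <= B.
Proof.
move=> Nhom B0 SB; apply: Pi_norm_le; apply: unit_family_summing => //.
  exact: Pi_linear.
move=> m f f1; apply: le_trans SB.
apply: (@le_trans _ _ (\sum_(i < m) \sum_(k < n) `|S k (f i)| `^ q)).
  apply: ler_sum => i _; rewrite Pi_sum.
  exact: (restr_window_upper Nhom n (fun k => S k (f i))).
rewrite exchange_big; apply: ler_sum => k _ /=.
exact: summing_unit_family.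
Qed.

Lemma sum_half_le2 n : \sum_(k < n) 2^-1 ^+ k <= 2 :> R.
Proof.
suff -> : \sum_(k < n) 2^-1 ^+ k = 2 - 2 * 2^-1 ^+ n :> R.
  by rewrite lerBlDr lerDl mulr_ge0// exprn_ge0// invr_ge0.
elim: n => [|n IH]; first by rewrite big_ord0 expr0 mulr1 subrr.
by rewrite big_ord_recr/= IH exprS; lra.
Qed.

Lemma rows_humps_upper (N : nat -> nat) (s : nat -> Pi) :
  {homo N : m n / (m <= n)%N} -> (forall k, `|s k| = 1) ->
  (forall k, `|rows (fun j => (j < N k)%N) (s k)| <= 2^-1 ^+ k) ->
  (forall k, `|s k - rows (fun j => (j < N k.+1)%N) (s k)| <= 2^-1 ^+ k) ->
  forall n (a : nat -> R),
    `|\sum_(k < n) a k *: s k| <= 5 * lq_norm q (fun k : 'I_n => a k).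
Proof.
move=> Nhom s1 sl sr n a.
pose t k := rows (fun j => (N k <= j < N k.+1)%N) (s k).
have st k : `|s k - t k| <= 2 * 2^-1 ^+ k.
  rewrite /t -rows_window ?Nhom//.
  rewrite opprB addrA addrAC; apply: le_trans (ler_normD _ _) _.
  by rewrite mulrDl mul1r; apply: lerD.
have -> : \sum_(k < n) a k *: s k
    = \sum_(k < n) a k *: t k + \sum_(k < n) a k *: (s k - t k).
  by rewrite -big_split/=; apply: eq_bigr => k _; rewrite -scalerDr subrKC.
set A := lq_norm q _; have A0 : 0 <= A by exact: lq_norm_ge0.
have aA (k : 'I_n) : `|a k| <= A.
  exact: (ler_norm_root_sum (fun k : 'I_n => a k) k q0).
apply: le_trans (ler_normD _ _) _.
rewrite (_ : 5 * A = A + 4 * A); last by lra.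
apply: lerD.
  have -> : \sum_(k < n) a k *: t k =
      \sum_(k < n) rows (fun j => (N k <= j < N k.+1)%N) (a k *: s k).
    apply: eq_bigr => k _.
    by have [_ _ -> _ _] := linearP0 (@rows_linear (fun j => (N k <= j < N k.+1)%N)).
  apply: (rows_window_upper (S := fun k => a k *: s k)) => //.
  under eq_bigr do rewrite normrZ s1 mulr1.
  by rewrite -lq_norm_leP.
apply: le_trans (ler_norm_sum _ _ _) _.
apply: (@le_trans _ _ (\sum_(k < n) A * (2 * 2^-1 ^+ k))).
  by apply: ler_sum => k _; rewrite normrZ; apply: ler_pM.
rewrite -mulr_sumr mulrC; apply: ler_wpM2r => //.
by rewrite -mulr_sumr; have := sum_half_le2 n; lra.
Qed.

Variable d : compatible_metric R K.
Local Notation cut k x := (@cutoff R K cK d k x).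

Lemma atom_rows E x S : atom d x (rows E S) = rows E (atom d x S).
Proof.
apply: cvg_lim => //.
have := cvg_bounded_linear (@rows_linear E) (B := 1) _ (@atom_cvg _ _ _ _ _ _ p1 pq d x S).
under eq_fun do rewrite rows_comp_mulc.
by apply => T; rewrite mul1r; exact: rows_norm.
Qed.

Lemma rows_atomE E x S f :
  rows E (atom d x S) f = f x *: restr E (atom d x S (cstc cK 1)).
Proof.
rewrite rowsE [in LHS]atomE.
have [_ _ RZ _ _] := linearP0 (@restr_linear _ _ (le_trans p1 pq) E).
exact: RZ.
Qed.

Lemma rows_atom_lower (N : nat -> nat) n x S : {homo N : m n / (m <= n)%N} ->
  lq_norm q (fun k : 'I_n => `|rows (fun j => (j < N k.+1)%N) (atom d x S)
     - rows (fun j => (j < N k)%N) (atom d x S)|) <= `|S|.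
Proof.
move=> Nhom; apply: le_trans (atom_value_norm d x S).
rewrite lq_norm_leP//; apply: le_trans (restr_window_lower Nhom n _).
apply: ler_sum => k _; rewrite normr_id powR_ler// rows_window ?Nhom//.
by apply: (@rank_one_norm _ _ _ _ _ _ p1 pq _ x) => f; exact: rows_atomE.
Qed.

(** Restricting [w] to finitely many rows and testing it on a near-norming family
    leaves finitely many scalars, to which finite-dimensional duality applies;
    the resulting functional reads only finitely many entries. *)
Lemma half_norming (w : Pi) :
  (rows (fun j => (j < N)%N) w @[N --> \oo] --> w) ->
  exists theta : {linear Pi -> R},
    (forall x, `|theta x| <= `|x|) /\ `|w| / 2 <= theta w.
Proof.
(* The truncation keeps three quarters of the norm. *)
have arith (a b c : R) : c <= a / 4 -> a <= c + b -> a * (3 / 4) <= b by lra.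
have arith2 (a b : R) : 0 < a -> a * (3 / 4) <= b -> a / 2 < b by lra.
move=> Pw; have [w0|wN0] := eqVneq w 0.
  by exists (\0 : {linear Pi -> R}); split=> [x|]; rewrite ?w0 normr0// mul0r.
have w0 : 0 < `|w| by rewrite normr_gt0.
have w40 : 0 < `|w| / 4 by rewrite divr_gt0.
have /cvgrPdist_le/(_ _ w40)[N _ /(_ N (leqnn N)) /= wN] := Pw.
set u := rows _ w in wN.
have tri : `|w| <= `|w - u| + `|u|.
  by rewrite -{1}(subrK u w); exact: ler_normD.
have wN' : `|w - u| <= `|w| / 4 by exact: wN.
have u34 := arith `|w| `|u| `|w - u| wN' tri.
have u2 := arith2 `|w| `|u| w0 u34.
have w20 : 0 <= `|w| / 2 := divr_ge0 (normr_ge0 w) (ler0n R 2).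
have e0 : 0 < `|u| `^ q - (`|w| / 2) `^ q.
  by rewrite subr_gt0; exact: (gt0_ltr_powR q0 w20 (normr_ge0 u) u2).
clear tri wN wN' u34 u2.
have [n [f [f1 fu]]] := near_norming_family u e0.
pose c (T : Pi) (ij : 'I_n * 'I_N) : R := lq_space_fun (T (f ij.1)) ij.2.
have csum (T : Pi) : \sum_ij `|c T ij| `^ q =
    \sum_(i < n) \sum_(j < N) `|lq_space_fun (T (f i)) j| `^ q.
  by rewrite pair_bigA.
have [b [bw bT]] := root_sum_dual (c w) q1.
pose th (T : Pi) : R := \sum_ij b ij * c T ij.
have thlin : linear th.
  move=> a S T; rewrite /th scaler_sumr -big_split/=; apply: eq_bigr => ij _.
  by rewrite /c PiD PiZ lq_spaceD lq_spaceZ mulrDr mulrCA.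
pose theta : {linear Pi -> R} := HB.pack th (GRing.isLinear.Build _ _ _ _ th thlin).
exists theta; split => [T|].
  apply: le_trans (bT (c T)) _.
  rewrite -(powR_ler q0 (powR_ge0 _ _) (normr_ge0 T)).
  rewrite (powRVK q0 (sum_powR_ge0 (c T) q)) csum.
  apply: le_trans (summing_unit_family T f1).
  by apply: ler_sum => i _; exact: lq_space_sum_le.
rewrite -[leRHS]/(th w) /th bw.
rewrite -(powR_ler q0 w20 (powR_ge0 _ _)).
rewrite (powRVK q0 (sum_powR_ge0 (c w) q)) csum.
move: fu; rewrite opprB addrC subrK => /le_trans; apply.
apply: ler_sum => i _; rewrite /u rowsE.
apply: le_trans (@restr_support_norm _ _ _ _ N _ _) _ => //.
by apply: ler_sum => j _; rewrite restrE ltn_ord.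
Qed.

End lq_valued.

(** * Approximation by finitely many rows and atoms *)

Lemma contraction_cvg_closed {R : realType} {X : normedModType R}
    (L : nat -> X -> X) (S : X) :
  (forall N, linear (L N)) -> (forall N T, `|L N T| <= `|T|) ->
  (forall e, 0 < e -> exists T, L N T @[N --> \oo] --> T /\ `|S - T| <= e) ->
  L N S @[N --> \oo] --> S.
Proof.
have arith (e : R) : e = e / 3 + e / 3 + e / 3 by lra.
move=> Llin L1 Lapp; apply/cvgrPdist_le => e e0.
have e30 : 0 < e / 3 by rewrite divr_gt0.
have [T [LT ST]] := Lapp _ e30.
have /cvgrPdist_le/(_ _ e30) := LT; apply: filterS => N TN.
have -> : S - L N S = (S - T) + (T - L N T) - L N (S - T).
  have [_ _ _ LB _] := linearP0 (Llin N).
  by rewrite LB opprB !subrKA.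
apply: le_trans (ler_normB _ _) _.
rewrite [leRHS](arith e); apply: lerD; last exact: (le_trans (L1 N (S - T)) ST).
exact: (le_trans (ler_normD _ _) (lerD ST TN)).
Qed.

Section density.
Context {R : realType} {K : topologicalType} {cK : compact [set: K]}.
Variables (p q : R) (p1 : 1 <= p) (pq : p <= q).
Let q1 : 1 <= q := le_trans p1 pq.
Let q0 : 0 < q. Proof. exact: lt_le_trans q1. Qed.
Local Notation CK := (continuous_functions R cK).
Local Notation lq := (lq_space (le_trans p1 pq)).
Local Notation Pi := (summing_operators CK lq p1 pq).
Variables (d : compatible_metric R K) (num : K -> nat).
Hypothesis num_inj : injective num.
Local Notation cut k x := (@cutoff R K cK d k x).
Local Notation below N := (fun j => (j < N)%N).

Lemma coord_linear j : linear (fun u : lq => lq_space_fun u j : R).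
Proof. by move=> a u v; rewrite lq_spaceD lq_spaceZ. Qed.

Lemma nth_atom_value i (S : Pi) j :
  lq_space_fun (S (nth_cutoff d num k i)) j @[k --> \oo] -->
  lq_space_fun (nth_atom d num i S (cstc cK 1)) j.
Proof.
have h := Pi_cvg_eval (f := cstc cK 1)
  (@nth_atom_cvg _ _ _ _ _ _ p1 pq d num i S).
have := cvg_bounded_linear (@coord_linear j) (B := 1) _ h.
have -> : (fun k => lq_space_fun
    ((comp_mulc (nth_cutoff d num k i) S : Pi) (cstc cK 1)) j) =
    (fun k => lq_space_fun (S (nth_cutoff d num k i)) j).
  apply/funext => k; rewrite comp_mulcE.
  by congr (lq_space_fun (summing_fun S _) j); apply: cfun_ext => x;
    rewrite mulcE mulr1.
by apply => u; rewrite mul1r; exact: lq_space_coord.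
Qed.

Lemma lq_norm1E n (a : 'I_n -> R) : lq_norm 1 a = \sum_i `|a i|.
Proof.
rewrite /lq_norm invr1 powRr1 ?sum_powR_ge0//.
by apply: eq_bigr => i _; rewrite powRr1.
Qed.

(** The row [f |-> (S f)_j] is a functional of norm at most [pi(S)]. Its masses are
    tested by a signed sum of disjoint cutoffs, a function of norm at most
    one. *)
Lemma nth_atom_values_sum N (S : Pi) j :
  \sum_(i < N) `|lq_space_fun (nth_atom d num i S (cstc cK 1)) j| <= `|S|.
Proof.
rewrite -lq_norm1E.
apply: (@lq_norm_lim _ 1 N _ \oo
  (fun k i => lq_space_fun (S (nth_cutoff d num k i)) j)) => //.
  by move=> i; exact: nth_atom_value.
apply: filterS (@nth_cutoff_sum _ _ cK d num N) => k k1.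
rewrite lq_norm1E.
pose g := \sum_(i < N) Num.sg (lq_space_fun (S (nth_cutoff d num k i)) j)
  *: nth_cutoff d num k i : CK.
have g1 : `|g| <= 1.
  apply: cfun_norm_le => // y; rewrite /g cfun_sum; apply: le_trans (k1 y).
  apply: le_trans (ler_norm_sum _ _ _) _; apply: ler_sum => i _.
  rewrite cfunZ normrM ler_piMl//.
  by rewrite normr_sg lern1 leq_b1.
have -> : \sum_(i < N) `|lq_space_fun (S (nth_cutoff d num k i)) j|
    = lq_space_fun (S g) j.
  have [_ _ _ _ Ssum] := linearP0 (Pi_linear S).
  have [_ _ SZ _ _] := linearP0 (Pi_linear S).
  have [_ _ _ _ csum] := linearP0 (@coord_linear j).
  rewrite /g Ssum csum; apply: eq_bigr => i _.
  by rewrite SZ lq_spaceZ -normrEsg.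
apply: le_trans (ler_norm _) _; apply: le_trans (lq_space_coord _ _) _.
apply: le_trans (Pi_norm S g) _.
exact: (ler_piMr (normr_ge0 S) g1).
Qed.

Lemma nth_atom_rowE i (S : Pi) j f :
  rows (pred1 j) (nth_atom d num i S) f =
  (if nth_point num i is Some x then f x else 0) *:
    restr (pred1 j) (nth_atom d num i S (cstc cK 1)).
Proof.
rewrite /nth_atom; case: nth_point => [x|]; first exact: rows_atomE.
rewrite scale0r rowsE.
by have [-> _ _ _ _] := linearP0 (@restr_linear _ _ (le_trans p1 pq) (pred1 j)).
Qed.

Lemma nth_atom_row_norm i (S : Pi) j :
  `|rows (pred1 j) (nth_atom d num i S)|
  <= `|lq_space_fun (nth_atom d num i S (cstc cK 1)) j|.
Proof.
apply: le_trans (restr_pred1_norm _ _).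
have := @nth_atom_rowE i S j; case: nth_point => [x|] rE.
  exact: (@rank_one_norm _ _ _ _ _ _ p1 pq _ x _ rE).
have -> : rows (pred1 j) (nth_atom d num i S) = 0.
  by apply: Pi_ext => f; rewrite rE scale0r.
by rewrite normr0; exact: normr_ge0.
Qed.

Lemma atoms_upto_row_lower (N : nat -> nat) n (S : Pi) j :
  {homo N : m n / (m <= n)%N} ->
  lq_norm 1 (fun k : 'I_n => `|rows (pred1 j) (atoms_upto d num (N k.+1) S)
    - rows (pred1 j) (atoms_upto d num (N k) S)|) <= `|S|.
Proof.
move=> Nhom; rewrite lq_norm1E.
pose F i := `|rows (pred1 j) (nth_atom d num i S)|.
apply: (@le_trans _ _ (\sum_(k < n) \sum_(N k <= i < N k.+1) F i)).
  apply: ler_sum => k _; rewrite normr_id.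
  have rlin : linear (rows (pred1 j) : Pi -> Pi) by exact: rows_linear.
  have [R0 RD _ RB _] := linearP0 rlin.
  rewrite -RB /atoms_upto -!(big_mkord xpredT (fun i => nth_atom d num i S)).
  rewrite (@big_cat_nat _ _ _ (N k) 0)//= ?Nhom// addrAC subrr add0r.
  rewrite (big_morph _ RD R0); exact: ler_norm_sum.
rewrite window_sum//; apply: le_trans (nth_atom_values_sum (N n) S j).
apply: (@le_trans _ _ (\sum_(i < N n) F i)).
  rewrite -(big_mkord xpredT F).
  rewrite [leRHS](@big_cat_nat _ _ _ (N 0%N))//= ?Nhom// lerDr.
  by apply: sumr_ge0 => i _; exact: normr_ge0.
by apply: ler_sum => i _; exact: nth_atom_row_norm.
Qed.

Definition approximable (S : Pi) : Prop :=
  rows (below N) S @[N --> \oo] --> S /\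
  atoms_upto d num N S @[N --> \oo] --> S.

Lemma approximable_closed S :
  (forall e, 0 < e -> exists T, approximable T /\ `|S - T| <= e) ->
  approximable S.
Proof.
move=> app; split.
  apply: (@contraction_cvg_closed _ Pi (fun N => rows (below N))) => [N|N T|e e0].
  - exact: rows_linear.
  - exact: rows_norm.
  - by have [T [[T1 _] ST]] := app e e0; exists T.
apply: (@contraction_cvg_closed _ Pi (fun N => atoms_upto d num N)) => [N|N T|e e0].
- exact: atoms_upto_linear.
- exact: atoms_upto_norm.
- by have [T [[_ T1] ST]] := app e e0; exists T.
Qed.

Lemma approximableD S T :
  approximable S -> approximable T -> approximable (S + T).
Proof.
move=> [S1 S2] [T1 T2]; split.
  have -> : (fun N => rows (below N) (S + T)) =
      (fun N => rows (below N) S + rows (below N) T).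
    apply/funext => N.
    have rlin : linear (rows (below N) : Pi -> Pi) by exact: rows_linear.
    by have [_ -> _ _ _] := linearP0 rlin.
  exact: cvgD.
have -> : (fun N => atoms_upto d num N (S + T)) =
    (fun N => atoms_upto d num N S + atoms_upto d num N T).
  apply/funext => N.
  have alin : linear (atoms_upto d num N : Pi -> Pi).
    exact: atoms_upto_linear.
  by have [_ -> _ _ _] := linearP0 alin.
exact: cvgD.
Qed.

Lemma approximable_comp_mulc h S : approximable S -> approximable (comp_mulc h S).
Proof.
have cb T : `|comp_mulc h T| <= `|h| * `|T :> Pi|.
  by rewrite mulrC; exact: comp_mulc_norm.
move=> [S1 S2]; split.
  have := cvg_bounded_linear (@comp_mulc_linearS _ _ _ _ _ _ p1 pq h) cb S1.
  by under eq_fun do rewrite -rows_comp_mulc.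
have := cvg_bounded_linear (@comp_mulc_linearS _ _ _ _ _ _ p1 pq h) cb S2.
by under eq_fun do rewrite -atoms_upto_comp_mulc.
Qed.

Lemma approximable0 : approximable 0.
Proof.
split.
  have -> : (fun N => rows (below N) 0) = (fun=> 0 : Pi).
    apply/funext => N.
    have rlin : linear (rows (below N) : Pi -> Pi) by exact: rows_linear.
    by have [-> _ _ _ _] := linearP0 rlin.
  exact: cvg_cst.
have -> : (fun N => atoms_upto d num N 0) = (fun=> 0 : Pi).
  apply/funext => N.
  have alin : linear (atoms_upto d num N : Pi -> Pi).
    exact: atoms_upto_linear.
  by have [-> _ _ _ _] := linearP0 alin.
exact: cvg_cst.
Qed.

Lemma approximable_atom x S : approximable (atom d x S).
Proof.
split; last first.
  by apply: cvg_near_cst; exists (num x).+1 => // N /= xN; exact: atoms_upto_atom.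
apply/cvgrPdist_le => e e0.
have /cvgrPdist_le/(_ _ e0) := @restr_cvg _ _ (le_trans p1 pq) (atom d x S (cstc cK 1)).
apply: filterS => N vN; apply: le_trans vN.
apply: (@rank_one_norm _ _ _ _ _ _ p1 pq _ x) => f.
by rewrite PiD PiN rows_atomE atomE scalerBr.
Qed.

(** The multipliers [h] for which [S o M_h] is approximable form an ideal. Near
    a point, [S o M_(cut k x)] is almost the atom of [S] there, and this is
    the test that proves the ideal to be everything. *)
Lemma scattered_approximable S : scattered K -> approximable S.
Proof.
move=> sK; rewrite -(comp_mulc_cst1 S).
apply: (@scattered_ideal _ _ _ d [set h | approximable (comp_mulc h S)]) => //=.
- by rewrite comp_mulc0; exact: approximable0.
- by move=> h g hS gS; rewrite comp_mulcD; exact: approximableD.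
- by move=> h g hS; rewrite -comp_mulc_mulc; exact: approximable_comp_mulc.
move=> x m mS; apply: approximable_closed => e e0.
have /cvgrPdist_le/(_ _ e0)[N _ /(_ (maxn N m) (leq_maxl N m))/= kS] :=
  @atom_cvg _ _ _ _ _ _ p1 pq d x S.
set k := maxn N m in kS.
exists (comp_mulc (cut m x - cut k x) S + atom d x S); split.
  apply: approximableD; last exact: approximable_atom.
  by apply: mS; exact: leq_maxr.
have -> : comp_mulc (cut m x) S - (comp_mulc (cut m x - cut k x) S + atom d x S)
    = - (atom d x S - comp_mulc (cut k x) S).
  by rewrite -comp_mulcB opprD addrA opprB subrKC opprB.
by rewrite normrN.
Qed.

End density.

(** * Persistent rows and atoms, and the three kinds of humps *)

Section persistence.
Context {R : realType} {X : normedModType R}.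
Variable Y : set X.

(** A weak form of [A] being bounded below on some infinite-dimensional subspace
    of [Y]: it provides humps satisfying finitely many linear conditions, and
    its negation passes to finite sums of operators. *)
Definition persistent (A : X -> X) : Prop :=
  exists c : R, 0 < c /\ forall Psi : seq {linear X -> R},
    exists x, [/\ Y x, `|x| = 1 & killed Psi x] /\ c <= `|A x|.

Lemma not_persistent_sum n (A : nat -> X -> X) (e : R) : 0 < e ->
  (forall i, (i < n)%N -> ~ persistent (A i)) ->
  exists Psi : seq {linear X -> R}, forall x, Y x -> `|x| = 1 ->
    killed Psi x -> \sum_(i < n) `|A i x| <= e.
Proof.
elim: n e => [|n IH] e e0 Ap.
  by exists [::] => x _ _ _; rewrite big_ord0 ltW.
have e20 : 0 < e / 2 by rewrite divr_gt0.
have [Psi PsiP] := IH _ e20 (fun i ni => Ap i (ltnW ni)).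
have [Phi PhiP] : exists Phi : seq {linear X -> R}, forall x, Y x ->
    `|x| = 1 -> killed Phi x -> `|A n x| <= e / 2.
  apply: contrapT => no; apply: (Ap n (ltnSn n)); exists (e / 2); split=> // Psi'.
  apply: contrapT => no'; apply: no; exists Psi' => x Yx x1 kx.
  by rewrite leNgt; apply/negP => /ltW lt; apply: no'; exists x.
exists (Psi ++ Phi) => x Yx x1; rewrite /killed all_cat => /andP[k1 k2].
by rewrite big_ord_recr/= [leRHS]splitr; apply: lerD; [exact: PsiP|exact: PhiP].
Qed.

Lemma unit_killed (Psi : seq {linear X -> R}) : submod_closed (mem Y) ->
  ~ finite_dimensional Y -> exists x, [/\ Y x, `|x| = 1 & killed Psi x].
Proof.
move=> Ysub Yinf; have [x [Yx x0 kx]] := infinite_dim_killed Psi Ysub Yinf.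
have [_ YZ _ _] := submodP Ysub.
exists (`|x|^-1 *: x); split; first exact: YZ.
  by rewrite normrZ normfV normr_id mulVf// normr_eq0.
apply: sub_all kx => g /= /eqP gx.
by rewrite linearZ /= gx scaler0.
Qed.

End persistence.

Section main.
Context {R : realType} {K : topologicalType} {cK : compact [set: K]}.
Variables (p q : R) (p1 : 1 <= p) (pq : p <= q).
Let q1 : 1 <= q := le_trans p1 pq.
Local Notation CK := (continuous_functions R cK).
Local Notation lq := (lq_space (le_trans p1 pq)).
Local Notation Pi := (summing_operators CK lq p1 pq).
Variables (d : compatible_metric R K) (num : K -> nat).
Hypothesis num_inj : injective num.
Hypothesis sK : scattered K.
Local Notation below N := (fun j => (j < N)%N).
Local Notation Q N := (atoms_upto d num N : Pi -> Pi).

Variable Y : set Pi.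
Hypotheses (Ysub : submod_closed (mem Y)) (Ycl : closed Y).
Hypothesis Yinf : ~ finite_dimensional Y.

Local Notation conclusion := (exists Z : set Pi,
  [/\ Z `<=` Y, closed_inf_dim_subspace Z & complemented Z]).

Let norming (w : Pi) : exists theta : {linear Pi -> R},
  (forall x, `|theta x| <= `|x|) /\ `|w| / 2 <= theta w.
Proof. by apply: half_norming; have [] := scattered_approximable d num_inj w sK. Qed.

(** A persistent row: its entries are scalar measures on [K], and the humps
    travel along the atoms. The closed span is a copy of l_1. *)
Lemma persistent_row_case j : persistent Y (rows (pred1 j) : Pi -> Pi) -> conclusion.
Proof.
move=> [c [c0 cP]].
refine (@gliding_hump R Pi Y 1 1 c (fun N S => rows (pred1 j) (Q N S))
  (fun _ _ => 0) (rows (pred1 j)) (fun=> 0) Ysub Ycl (lexx 1) ler01 c0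
  _ _ _ _ _ norming _).
- by move=> N a S T; rewrite atoms_upto_linear rows_linear.
- move=> S; have [_ QS] := scattered_approximable d num_inj S sK.
  apply: (@cvg_bounded_linear _ Pi Pi (rows (pred1 j)) 1) QS.
    exact: rows_linear.
  by move=> T; rewrite mul1r; exact: rows_norm.
- by move=> S; exact: cvg_cst.
- by move=> N Nhom n S; rewrite mul1r; exact: atoms_upto_row_lower.
- move=> N s _ s1 _ _ n a; rewrite mul1r lq_norm1E.
  apply: le_trans (ler_norm_sum _ _ _) _; apply: ler_sum => k _.
  by rewrite normrZ s1 mulr1.
move=> Psi N e e0.
(* The row of an atom vanishes as soon as one scalar does, so finitely many
   conditions clear the row on the first [N] atoms. *)
pose v i (S : Pi) : R := lq_space_fun (nth_atom d num i S (cstc cK 1)) j.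
have vlin i : linear (v i).
  move=> a S T; rewrite /v nth_atom_linear PiD PiZ lq_spaceD lq_spaceZ.
  reflexivity.
pose V i : {linear Pi -> R} := HB.pack (v i) (GRing.isLinear.Build _ _ _ _ (v i) (vlin i)).
have [x [[Yx x1]]] := cP (Psi ++ [seq V i | i <- iota 0 N]).
rewrite /killed all_cat => /andP[kx kv] cx.
exists x; split; split; [exact: Yx|exact: x1|exact: kx|exact: cx| |];
  last by rewrite normr0; exact: ltW.
have -> : rows (pred1 j) (Q N x) = 0; last by rewrite normr0; exact: ltW.
have rlin : linear (rows (pred1 j) : Pi -> Pi) by exact: rows_linear.
have [_ _ _ _ ->] := linearP0 rlin.
apply: big1 => i _.
have vi : lq_space_fun (nth_atom d num i x (cstc cK 1)) j = 0.
  move: kv; rewrite all_map => /allP/(_ (i : nat)).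
  by rewrite mem_iota /= ltn_ord => /(_ isT)/eqP.
have := nth_atom_row_norm d num i x j; rewrite vi normr0 normr_le0.
by move=> /eqP.
Qed.

Section no_persistent_row.
Hypothesis no_row : forall j, ~ persistent Y (rows (pred1 j) : Pi -> Pi).

Let small_rows N (e : R) : 0 < e -> exists Psi : seq {linear Pi -> R},
  forall x, Y x -> `|x| = 1 -> killed Psi x -> `|rows (below N) x| <= e.
Proof.
move=> e0; have [Psi PsiP] := @not_persistent_sum _ _ Y N
  (fun j => rows (pred1 j)) e e0 (fun j _ => @no_row j).
exists Psi => x Yx x1 kx; rewrite rows_split.
exact: le_trans (ler_norm_sum _ _ _) (PsiP x Yx x1 kx).
Qed.

Let upper (N : nat -> nat) (s : nat -> Pi) :
  {homo N : m n / (m <= n)%N} -> (forall k, `|s k| = 1) ->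
  (forall k, `|rows (below (N k)) (s k)| <= 2^-1 ^+ k) ->
  (forall k, `|s k - rows (below (N k.+1)) (s k)| <= 2^-1 ^+ k) ->
  forall n (a : nat -> R),
    `|\sum_(k < n) a k *: s k| <= 5 * lq_norm q (fun k : 'I_n => a k).
Proof. exact: rows_humps_upper. Qed.

Let le5 (S : Pi) (t : R) : t <= `|S| -> t <= 5 * `|S|.
Proof. by move=> /le_trans; apply; rewrite ler_peMl// ler1n. Qed.

(** A persistent atom: its entries are vectors of l_q, and the humps travel
    along the rows. *)
Lemma persistent_atom_case x : persistent Y (atom d x : Pi -> Pi) -> conclusion.
Proof.
move=> [c [c0 cP]].
refine (@gliding_hump R Pi Y q 5 c (fun N S => rows (below N) (atom d x S))
  (fun N S => rows (below N) S) (atom d x) (fun S => S) Ysub Ycl q1 (ler0n R 5)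
  c0 _ _ _ _ upper norming _).
- by move=> N a S T; rewrite atom_linear rows_linear.
- by move=> S; have [] := scattered_approximable d num_inj (atom d x S) sK.
- by move=> S; have [] := scattered_approximable d num_inj S sK.
- by move=> N Nhom n S; apply: le5; exact: rows_atom_lower.
move=> Psi N e e0; have [Phi PhiP] := small_rows N e0.
have [S [[YS S1]]] := cP (Psi ++ Phi).
rewrite /killed all_cat => /andP[k1 k2] cS.
have rS := PhiP S YS S1 k2.
exists S; split; split; [exact: YS|exact: S1|exact: k1|exact: cS| |exact: rS].
by rewrite -atom_rows; exact: (le_trans (atom_norm _ _ _) rS).
Qed.

(** Neither a persistent row nor a persistent atom: humps can be pushed beyond
    any finite set of rows and any finite set of atoms at once. *)
Lemma no_persistent_atom_case :
  (forall x, ~ persistent Y (atom d x : Pi -> Pi)) -> conclusion.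
Proof.
move=> no_atom.
refine (@gliding_hump R Pi Y q 5 1 (fun N => Q N)
  (fun N S => rows (below N) S) (fun S => S) (fun S => S) Ysub Ycl q1
  (ler0n R 5) ltr01 _ _ _ _ upper norming _).
- by move=> N; exact: atoms_upto_linear.
- by move=> S; have [] := scattered_approximable d num_inj S sK.
- by move=> S; have [] := scattered_approximable d num_inj S sK.
- by move=> N Nhom n S; apply: le5; exact: atoms_upto_lower.
move=> Psi N e e0; have [Phi PhiP] := small_rows N e0.
have no_nth i : ~ persistent Y (nth_atom d num i : Pi -> Pi).
  rewrite /nth_atom; case: nth_point => [x|]; first exact: no_atom.
  move=> [c [c0 /(_ [::])[x [_]]]]; rewrite normr0.
  by move=> /(lt_le_trans c0); rewrite ltxx.
have [Chi ChiP] := @not_persistent_sum _ _ Y N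
  (fun i => nth_atom d num i) e e0 (fun i _ => no_nth i).
have [S [YS S1]] := unit_killed (Psi ++ Phi ++ Chi) Ysub Yinf.
rewrite /killed !all_cat => /and3P[k1 k2 k3].
have rS := PhiP S YS S1 k2; have aS := ChiP S YS S1 k3.
exists S; split; split; [exact: YS|exact: S1|exact: k1| | |exact: rS].
  by rewrite S1.
exact: (le_trans (ler_norm_sum _ _ _) aS).
Qed.

End no_persistent_row.
End main.

Theorem proposition4p4 (R : realType) (K : topologicalType)
    (cK : compact [set: K]) (mK : metrizable R K) (sK : scattered K)
    (p q : R) (p1 : 1 <= p) (pq : p <= q) :
  subprojective (summing_operators (continuous_functions R cK)
                   (lq_space (le_trans p1 pq)) p1 pq).
Proof.
move=> Y [Ysub Ycl Yinf].
have [dist [dist0 distC dist_tri dist_nbhs]] := mK.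
pose d := CompatibleMetric dist0 distC dist_tri dist_nbhs.
have /countable_injP[num num_inj] := @scattered_countable R K cK d sK.
have {}num_inj : injective num.
  by move=> x y; apply: num_inj; rewrite inE.
have [[j rowj]|no_row] := pselect (exists j, persistent Y (rows (pred1 j))).
  exact: (persistent_row_case d num_inj sK Ysub Ycl rowj).
have {}no_row j : ~ persistent Y (rows (pred1 j)).
  by move=> rowj; apply: no_row; exists j.
have [[x atomx]|no_atom] := pselect (exists x, persistent Y (atom d x)).
  exact: (persistent_atom_case num_inj sK Ysub Ycl no_row atomx).
apply: (no_persistent_atom_case num_inj sK Ysub Ycl Yinf no_row (d := d)).
by move=> x atomx; apply: no_atom; exists x.
Qed.
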